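(* Let $n$ be a positive even integer. Then the distribution $$\lambda i_n(x)=\sum_{k=0}^{n-1}B_k\,\frac{(-2x)^k}{k!}\cdot\mathrm{li}_{n-k}(x)$$ on $\mathbb{R}$ is a smooth function of $x$.
   Context: The Bernoulli numbers $B_k$ are normalized by $\sum_{k\ge0}B_k\frac{x^k}{k!}=\frac{x}{1-e^{-x}}$ (so $B_1=+\tfrac12$). For $\mathrm{Re}\, s>0$, $\gamma_+^s$ is the tempered distribution on $\mathbb{R}$ given by the function equal to $x^{s-1}/\Gamma(s)$ for $x>0$ and $0$ for $x<0$. For $s\in\mathbb{C}$ with $\mathrm{Re}\,s>0$ the tempered distribution $\mathrm{li}_s$ on $\mathbb{R}$ is the convolution $\gamma_+^s*\mathrm{PV}\frac{1}{e^{-x}-1}$, i.e. for Schwartz functions $f$, $$\langle \mathrm{li}_s,f\rangle=\lim_{\epsilon\to0^+}\int_{|t|>\epsilon}\frac{1}{e^{-t}-1}\,\langle\gamma_+^s, f(\cdot+t)\rangle\,dt .$$ On $x<0$ it coincides with $\sum_{m\ge1}e^{mx}/m^s$. *)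

(* Defs.v *)
From HB Require Import structures.
From mathcomp Require Import all_boot all_order all_algebra.
From mathcomp Require Import complex.
From mathcomp Require Import all_classical all_reals all_analysis.

Set Implicit Arguments.
Unset Strict Implicit.
Unset Printing Implicit Defensive.

Import Order.TTheory GRing.Theory Num.Theory.
Import numFieldNormedType.Exports.

Local Open Scope classical_set_scope.
Local Open Scope ring_scope.
Local Open Scope complex_scope.

(* Calculus of complex-valued functions of a real variable: derivatives,
   limits and integrals are taken on real and imaginary parts. *)

Definition smooth (R : realType) (f : R -> R) : Prop :=
  forall (m : nat) (x : R), derivable (derive1n m f) x 1.

Definition csmooth (R : realType) (f : R -> R[i]) : Prop :=
  smooth (fun x => complex.Re (f x)) /\ smooth (fun x => complex.Im (f x)).

Definition schwartz (R : realType) (f : R -> R) : Prop :=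
  smooth f /\
  forall k m : nat, exists M : R, forall x : R, `|x ^+ k * derive1n m f x| <= M.

Definition cschwartz (R : realType) (f : R -> R[i]) : Prop :=
  schwartz (fun x => complex.Re (f x)) /\ schwartz (fun x => complex.Im (f x)).

Definition cintegrable (R : realType) (D : set R) (f : R -> R[i]) : Prop :=
  (@lebesgue_measure R).-integrable D (EFin \o (fun x => complex.Re (f x))) /\
  (@lebesgue_measure R).-integrable D (EFin \o (fun x => complex.Im (f x))).

Definition cintegral (R : realType) (D : set R) (f : R -> R[i]) : R[i] :=
  Rintegral (@lebesgue_measure R) D (fun x => complex.Re (f x)) +i*
  Rintegral (@lebesgue_measure R) D (fun x => complex.Im (f x)).

Definition clim_right0 (R : realType) (h : R -> R[i]) : R[i] :=
  lim (complex.Re (h e) @[e --> 0^'+]) +i* lim (complex.Im (h e) @[e --> 0^'+]).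

(* x ^ s = exp (s ln x); only meaningful for x > 0. *)
Definition cpow (R : realType) (x : R) (s : R[i]) : R[i] :=
  (expR (complex.Re s * ln x))%:C *
  (cos (complex.Im s * ln x) +i* sin (complex.Im s * ln x)).

(* Euler's integral, hence only meaningful for Re s > 0. *)
Definition Gamma (R : realType) (s : R[i]) : R[i] :=
  cintegral [set t : R | 0 < t] (fun t => cpow t (s - 1) * (expR (- t))%:C).

(* Distributions are represented by their underlying functionals; those below
   are tempered, so only their values on Schwartz functions matter. *)
Definition functional (R : realType) : Type := (R -> R[i]) -> R[i].

(* The functional given by a function g. *)
Definition regular (R : realType) (g : R -> R[i]) : functional R :=
  fun f => cintegral setT (fun x => g x * f x).

Definition dmul (R : realType) (p : R -> R[i]) (T : functional R) :
  functional R := fun f => T (fun x => p x * f x).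

(* T is, as a tempered distribution, given by the function g; integrability is
   required because the integral in regular is total. *)
Definition given_by (R : realType) (T : functional R) (g : R -> R[i]) : Prop :=
  forall f : R -> R[i], cschwartz f ->
    cintegrable setT (fun x => g x * f x) /\ T f = regular g f.

Definition gamma_plus (R : realType) (s : R[i]) : functional R :=
  regular (fun x : R => if 0 < x then cpow x (s - 1) / Gamma s else 0).

Definition li (R : realType) (s : R[i]) : functional R :=
  fun f => clim_right0 (fun e : R =>
    cintegral [set t : R | e < `|t|] (fun t =>
      ((expR (- t) - 1)^-1)%:C * gamma_plus s (fun x => f (x + t)))).

(* Generating function of the Bernoulli numbers with B_1 = 1/2, near 0; the
   point 0 is excluded because x / (1 - exp (- x)) is 0 / 0 there. *)
Definition bernoulli_numbers (R : realType) (B : nat -> R) : Prop :=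
  \forall x \near (0 : R)^',
    series (fun k => B k * (x ^+ k / (k`!)%:R)) @ \oo --> x / (1 - expR (- x)).

Definition lambda_i (R : realType) (B : nat -> R) (n : nat) : functional R :=
  fun f => \sum_(k < n)
    dmul (fun x : R => (B k * ((- 2 * x) ^+ k / (k`!)%:R))%:C)
         (li (n - k)%:R) f.

(* Main.v *)
Require Import Defs.
From HB Require Import structures.
From mathcomp Require Import all_boot all_order all_algebra.
From mathcomp Require Import complex ring lra.
From mathcomp Require Import all_classical all_reals all_analysis.
From mathcomp Require Import measurable_realfun.

(* Put K(t) = 1/(exp(-t) - 1) and b(t) = t/(1 - exp(-t)), so that -t K(t) = b(t)
   is smooth.  Expanding gamma_+^m binomially, li_m tested against q becomes a
   combination over i < m of the principal values of K(t) (-t)^i T(t), where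
   T(t) is the integral over y > t of y^(m-1-i) q(y).  For i > 0 the factor t^i
   cancels the pole, and Fubini turns the term into the integral of y^(m-1-i) q(y)
   against the primitive from -oo of the smooth function b(t) (-t)^(i-1).  The
   terms with i = 0 are genuinely singular, but in lambda i_n they are all
   multiples of the same principal value, that of y^(n-1) f(y), with total
   coefficient sum_(k < n) B_k (-2)^k / (k! (n-1-k)!).  This is the (n-1)-st Taylor
   coefficient of b(-2z) exp(z) = z / sinh z, which is even, and n - 1 is odd. *)

Set Implicit Arguments.
Unset Strict Implicit.
Unset Printing Implicit Defensive.

Import Order.TTheory GRing.Theory Num.Theory.
Import numFieldNormedType.Exports.

Local Open Scope classical_set_scope.
Local Open Scope ring_scope.

(** * Smooth functions and the Bernoulli generating function *)

(** The tails T do not decay at -oo, where they tend to a full integral, while b(t) grows linearly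
    at +oo. A weight b(t) (-t)^j is nevertheless integrable against T: the identity b(-s) = exp(-s)
    b(s) supplies decay on the left, and T supplies it on the right. The same decay on the left
    makes the primitive from -oo exist. Limits and integrals are total functions here, so an
    identity between them has content only with convergence or integrability beside it; each term is
    therefore shown to converge by itself before the terms are added. The Bernoulli numbers are
    known only through pointwise convergence of their generating series near 0, off 0 itself. The
    singular coefficient is accordingly read off by comparing truncations modulo O(x^n) on punctured
    neighbourhoods. *)

Section smooth.
Context {R : realType}.
Implicit Types f g : R -> R.

(** A finite order, with the first derivative taken off first, suits induction: the derivatives of f
    g and 1/f are built from f, g, 1/f and first derivatives, all of which are controlled at the
    previous order. *)
Fixpoint smooth_upto (m : nat) f : Prop :=
  (forall x, derivable f x 1) /\
  if m is m'.+1 then smooth_upto m' (derive1 f) else True.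

Lemma smooth_uptoP f : smooth f <-> forall m, smooth_upto m f.
Proof.
split=> [sf m|sf m x].
  elim: m f sf => [|m IH] f sf /=; split=> //; first exact: (sf 0%N).
    exact: (sf 0%N).
  by apply: IH => k x; have := sf k.+1 x; rewrite derive1Sn.
elim: m f sf => [|m IH] f sf; first by case: (sf 0%N).
by rewrite derive1Sn; apply: IH => k; case: (sf k.+1).
Qed.

Lemma smooth_uptoW m f : smooth_upto m.+1 f -> smooth_upto m f.
Proof.
by elim: m f => [|m IH] f [df sf]; split=> //; exact: IH.
Qed.

Lemma smooth_uptoD m f g :
  smooth_upto m f -> smooth_upto m g -> smooth_upto m (fun x => f x + g x).
Proof.
elim: m f g => [|m IH] f g [df sf] [dg sg]; split.
- by move=> x; exact: derivableD.
- exact: I.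
- by move=> x; exact: derivableD.
- have -> : derive1 (fun x => f x + g x) = (fun x => derive1 f x + derive1 g x).
    by apply/funext => x; rewrite !derive1E deriveD.
  exact: IH.
Qed.

Lemma smooth_uptoM m f g :
  smooth_upto m f -> smooth_upto m g -> smooth_upto m (fun x => f x * g x).
Proof.
elim: m f g => [|m IH] f g sf sg.
  case: sf sg => df _ [dg _]; split; last exact: I.
  by move=> x; exact: derivableM.
have [df df'] := sf; have [dg dg'] := sg; split=> [x|].
  exact: derivableM.
have -> : derive1 (fun x => f x * g x) =
  (fun x => f x * derive1 g x + g x * derive1 f x).
  by apply/funext => x; rewrite !derive1E deriveM.
by apply: smooth_uptoD; apply: IH => //; exact: smooth_uptoW.
Qed.

Lemma smooth_uptoC m (c : R) : smooth_upto m (fun=> c).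
Proof.
elim: m c => [|m IH] c; split=> //.
have -> : derive1 (fun _ : R => c) = (fun=> 0).
  by apply/funext => x; rewrite derive1E derive_cst.
exact: IH.
Qed.

Lemma smooth_uptoV m f : (forall x, f x != 0) ->
  smooth_upto m f -> smooth_upto m (fun x => (f x)^-1).
Proof.
move=> f0; elim: m f f0 => [|m IH] f f0 sf.
  case: sf => df _; split; last exact: I.
  by move=> x; exact: derivableV.
have [df df'] := sf; split=> [x|]; first exact: derivableV.
have -> : derive1 (fun x => (f x)^-1) =
    (fun x => (- 1 * ((f x)^-1 * (f x)^-1)) * derive1 f x).
  by apply/funext => x;
    rewrite !derive1E deriveV// /GRing.scale/= mulN1r -invfM -expr2.
have sV := IH f f0 (smooth_uptoW sf).
apply: smooth_uptoM => //; apply: smooth_uptoM; last exact: smooth_uptoM.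
exact: smooth_uptoC.
Qed.

Lemma smooth_upto_id m : smooth_upto m (fun x : R => x).
Proof.
case: m => [|m]; split=> //.
have -> : derive1 (fun x : R => x) = (fun=> 1).
  by apply/funext => x; rewrite derive1E derive_id.
exact: smooth_uptoC.
Qed.


Lemma smoothC (c : R) : smooth (fun=> c).
Proof. by apply/smooth_uptoP => m; exact: smooth_uptoC. Qed.

Lemma smooth_id : smooth (fun x : R => x).
Proof. by apply/smooth_uptoP => m; exact: smooth_upto_id. Qed.

Lemma smoothD f g : smooth f -> smooth g -> smooth (fun x => f x + g x).
Proof.
move=> /smooth_uptoP sf /smooth_uptoP sg; apply/smooth_uptoP => m.
exact: smooth_uptoD.
Qed.

Lemma smoothM f g : smooth f -> smooth g -> smooth (fun x => f x * g x).
Proof.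
move=> /smooth_uptoP sf /smooth_uptoP sg; apply/smooth_uptoP => m.
exact: smooth_uptoM.
Qed.

Lemma smoothV f : (forall x, f x != 0) -> smooth f -> smooth (fun x => (f x)^-1).
Proof.
move=> f0 /smooth_uptoP sf; apply/smooth_uptoP => m; exact: smooth_uptoV.
Qed.

Lemma smoothX f n : smooth f -> smooth (fun x => f x ^+ n).
Proof.
move=> sf; elim: n => [|n IH]; first exact: smoothC.
have -> : (fun x => f x ^+ n.+1) = (fun x => f x * f x ^+ n).
  by apply/funext => x; rewrite exprS.
exact: smoothM.
Qed.

Lemma smooth_sum I (s : seq I) (F : I -> R -> R) :
  (forall i, smooth (F i)) -> smooth (fun x => \sum_(i <- s) F i x).
Proof.
move=> sF; elim: s => [|i s IH].
  have -> : (fun x => \sum_(i <- [::]) F i x) = (fun=> 0).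
    by apply/funext => x; rewrite big_nil.
  exact: smoothC.
have -> : (fun x => \sum_(j <- i :: s) F j x) =
    (fun x => F i x + \sum_(j <- s) F j x).
  by apply/funext => x; rewrite big_cons.
exact: (smoothD (sF i) IH).
Qed.

Lemma smooth_derivable f x : smooth f -> derivable f x 1.
Proof. by move=> /(_ 0%N x). Qed.

Lemma smooth_continuous f : smooth f -> continuous f.
Proof.
move=> sf x; apply: differentiable_continuous; apply/derivable1_diffP.
exact: smooth_derivable.
Qed.

Lemma smooth_primitive (F f : R -> R) :
  (forall x : R, is_derive x (1 : R) F (f x)) -> smooth f -> smooth F.
Proof.
move=> dF sf [|m] x; first by have [] := dF x.
rewrite derive1Sn (_ : derive1 F = f); first exact: sf.
by apply/funext => y; rewrite derive1E derive_val.
Qed.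

(** * Power series with coefficients of size at most C/k! *)

Lemma cvg_pseries_le_inv_fact (c : R^nat) (C x : R) :
  (forall k, `|c k| <= C / k`!%:R) -> cvgn (pseries c x).
Proof.
move=> cC; apply: normed_cvg.
apply: (@series_le_cvg _ _ (fun k => C * exp_coeff `|x| k)).
- by move=> k /=.
- move=> k; rewrite /exp_coeff/= mulr_ge0 ?divr_ge0 ?exprn_ge0//.
  by have := le_trans (normr_ge0 _) (cC 0%N); rewrite fact0 divr1.
- move=> k; rewrite /exp_coeff/= normrM normrX mulrA mulrAC.
  by rewrite ler_wpM2r// exprn_ge0.
- rewrite (_ : series _ = (fun n => C * series (exp_coeff `|x|) n)); last first.
    by apply/funext => n; rewrite /series/= mulr_sumr.
  by apply: is_cvgM; [exact: is_cvg_cst|exact: is_cvg_series_exp_coeff].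
Qed.

(** Since (k+1)/(k+1)! = 1/k!, formal differentiation preserves the bound with the same C. This lets
    termwise differentiation be iterated in [smooth_pseries]. *)
Lemma pseries_diffs_le_inv_fact (c : R^nat) (C : R) :
  (forall k, `|c k| <= C / k`!%:R) ->
  forall k, `|pseries_diffs c k| <= C / k`!%:R.
Proof.
move=> cC k; rewrite /pseries_diffs normrM ger0_norm//.
rewrite (le_trans (ler_wpM2l _ (cC k.+1)))// factS natrM invfM mulrCA mulVKf//.
Qed.

Lemma smooth_pseries (c : R^nat) (C : R) :
  (forall k, `|c k| <= C / k`!%:R) -> smooth (fun x => limn (pseries c x)).
Proof.
have dc (d : R^nat) (dC : forall k, `|d k| <= C / k`!%:R) (x : R) :
    is_derive x (1 : R) (fun x => limn (pseries d x))
      (limn (pseries (pseries_diffs d) x)).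
  have dC' := pseries_diffs_le_inv_fact dC.
  apply: (@pseries_snd_diffs _ d (`|x| + 1)).
  - exact: cvg_pseries_le_inv_fact dC.
  - exact: cvg_pseries_le_inv_fact dC'.
  - exact: cvg_pseries_le_inv_fact (pseries_diffs_le_inv_fact dC').
  - by rewrite (ger0_norm (addr_ge0 _ _))// ltrDl.
move=> cC; apply/smooth_uptoP => m; elim: m c cC => [|m IH] c cC.
  split; last exact: I.
  by move=> x; have [] := dc c cC x.
split; first by move=> x; have [] := dc c cC x.
rewrite (_ : derive1 _ = fun x => limn (pseries (pseries_diffs c) x)).
  by apply: IH; exact: pseries_diffs_le_inv_fact.
by apply/funext => x; have dx := dc c cC x; rewrite derive1E derive_val.
Qed.

(** The entire function (1 - exp(-x))/x. As a power series it is smooth across 0 with value 1 there,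
    so no removable singularity has to be treated. *)
Definition exp_quotient (x : R) : R :=
  limn (pseries (fun k => (-1) ^+ k / k.+1`!%:R) x).

Let exp_quotient_coef k : `|(-1) ^+ k / k.+1`!%:R : R| <= 1 / k`!%:R.
Proof.
rewrite normrM normrX normrN1 expr1n !mul1r normfV ger0_norm//.
by rewrite lef_pV2 ?posrE ?ltr0n ?fact_gt0// ler_nat factS leq_pmull.
Qed.

Lemma smooth_exp_quotient : smooth exp_quotient.
Proof. exact: smooth_pseries exp_quotient_coef. Qed.

Lemma exp_quotient0 : exp_quotient 0 = 1.
Proof.
apply/cvg_lim => //; apply/cvg_ballP => e e0; exists 1%N => // n /= n0.
rewrite /pseries/series/= (big_cat_nat (n := 1%N))//= big_nat1.
rewrite big_nat_cond big1 ?addr0 ?expr0 ?mulr1 ?divr1; first exact: ballxx.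
by move=> [|i]//= _; rewrite expr0n/= mulr0.
Qed.

Lemma exp_quotientE x : x * exp_quotient x = 1 - expR (- x).
Proof.
have cq := cvg_pseries_le_inv_fact (x := x) exp_quotient_coef.
have ce : series (exp_coeff (- x)) @ \oo --> expR (- x).
  exact: is_cvg_series_exp_coeff.
suff : series (exp_coeff (- x)) n.+1 @[n --> \oo] --> 1 - x * exp_quotient x.
  rewrite (cvg_shiftS (series (exp_coeff (- x)))) => h.
  by rewrite -(cvg_unique _ h ce)// opprB addrCA subrr addr0.
rewrite (_ : (fun n => series (exp_coeff (- x)) n.+1) = (fun n => 1 - x *
    pseries (fun k => (-1) ^+ k / k.+1`!%:R) x n)).
  by apply: cvgB; [exact: cvg_cst|apply: cvgM; [exact: cvg_cst|exact: cq]].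
apply/funext => n; rewrite /pseries /series/= big_nat_recl//= {1}/exp_coeff/=.
rewrite expr0 fact0 divr1 mulr_sumr -sumrN; congr (_ + _); apply: eq_bigr => k _.
by rewrite /exp_coeff/= [(- x) ^+ _]exprNn !exprS; ring.
Qed.

Lemma expRN_lt1 (x : R) : 0 < x -> 0 < 1 - expR (- x).
Proof. by move=> x0; rewrite subr_gt0 expR_lt1 oppr_lt0. Qed.

Lemma exp_quotient_gt0 x : 0 < exp_quotient x.
Proof.
have [x0|x0|<-] := ltgtP 0 x; last by rewrite exp_quotient0.
  by rewrite -(pmulr_rgt0 _ x0) exp_quotientE expRN_lt1.
by rewrite -(nmulr_rlt0 _ x0) exp_quotientE subr_lt0 expR_gt1 oppr_gt0.
Qed.

Definition bern (x : R) := (exp_quotient x)^-1.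

Lemma bern0 : bern 0 = 1.
Proof. by rewrite /bern exp_quotient0 invr1. Qed.

Lemma bern_gt0 x : 0 < bern x.
Proof. by rewrite invr_gt0 exp_quotient_gt0. Qed.

Lemma smooth_bern : smooth bern.
Proof.
apply: smoothV smooth_exp_quotient => x.
by rewrite gt_eqF// exp_quotient_gt0.
Qed.

Lemma bernM x : bern x * (1 - expR (- x)) = x.
Proof. by rewrite -exp_quotientE /bern mulrCA mulVf ?mulr1// gt_eqF//
  exp_quotient_gt0. Qed.

Lemma bernE x : x != 0 -> bern x = x / (1 - expR (- x)).
Proof.
move=> x0; rewrite -{2}[x]bernM mulfK// subr_eq0 eq_sym.
by rewrite -expR0 (inj_eq (@expR_inj R)) oppr_eq0.
Qed.

(** Turns the linear growth of [bern] on the right into exponential decay on the left, and underlies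
    the parity of x / sinh x. *)
Lemma bernN_expR x : bern (- x) = expR (- x) * bern x.
Proof.
have [->|x0] := eqVneq x 0; first by rewrite !oppr0 expR0 mul1r.
have e1 y : y != 0 -> 1 - expR y != 0 :> R.
  by move=> y0; rewrite subr_eq0 eq_sym -expR0 (inj_eq (@expR_inj R)).
apply: (mulIf (e1 x x0)); have := bernM (- x); rewrite opprK => ->.
rewrite (_ : _ * _ * _ = expR (- x) * bern x - bern x * (expR x * expR (- x))).
  by rewrite expRxMexpNx_1 -{1}(bernM x); ring.
by ring.
Qed.

Lemma bernN x : bern (- x) = bern x - x.
Proof. by rewrite -{3}[x]bernM bernN_expR; ring. Qed.

Lemma bern_ge1 x : 0 <= x -> 1 <= bern x.
Proof.
rewrite le_eqVlt => /predU1P[<-|x0]; first by rewrite bern0.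
rewrite bernE ?gt_eqF// ler_pdivlMr ?expRN_lt1// mul1r lerBlDr -lerBlDl.
exact: expR_ge1Dx.
Qed.

Lemma bern_le1D x : 0 <= x -> bern x <= 1 + x.
Proof.
rewrite le_eqVlt => /predU1P[<-|x0]; first by rewrite bern0 addr0.
rewrite bernE ?gt_eqF// ler_pdivrMr ?expRN_lt1//.
suff : (1 + x) * expR (- x) <= 1 by nra.
by rewrite expRN ler_pdivrMr ?expR_gt0// mul1r expR_ge1Dx.
Qed.

(** For x >= 0 this is 1 <= b(x) <= 1 + x, and b(-x) = b(x) - x carries it to x < 0. It is the
    cancellation of the kernel at 0 needed for the principal value. *)
Lemma bern_sub1_le x : `|bern x - 1| <= `|x|.
Proof.
wlog x0 : x / 0 <= x => [H|].
  have [|/ltW x0] := leP 0 x; first exact: H.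
  have := H (- x); rewrite oppr_ge0 normrN => /(_ x0); rewrite bernN.
  have := @bern_ge1 (- x); have := @bern_le1D (- x);
    rewrite oppr_ge0 bernN => /(_ x0) h1 /(_ x0) h2 _.
  rewrite ler_norml (ler0_norm x0); apply/andP; split; lra.
rewrite ger0_norm ?(ger0_norm x0) ?subr_ge0 ?bern_ge1// lerBlDl.
exact: bern_le1D.
Qed.
End smooth.

(** * Integrals of rapidly decreasing functions against tempered kernels *)

Section integrals.
Context {R : realType}.
Local Notation mu := (@lebesgue_measure R).
Implicit Types f g h w phi : R -> R.

Lemma continuous_funM f g : continuous f -> continuous g ->
  continuous (fun x => f x * g x).
Proof. by move=> cf cg x; apply: cvgM; [exact: cf|exact: cg]. Qed.

Lemma oneDsqr_gt0 (x : R) : 0 < oneDsqr x.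
Proof. exact: lt_le_trans ltr01 (oneDsqr_ge1 x). Qed.

Lemma integrable_oneDsqrV :
  mu.-integrable setT (EFin \o (fun x : R => (oneDsqr x)^-1)).
Proof.
apply/integrableP; split.
  by apply/measurable_EFinP; apply: continuous_measurable_fun;
    exact: continuous_oneDsqrV.
under eq_integral => x _ do rewrite /= ger0_norm ?invr_ge0//.
rewrite ge0_symfun_integralT.
- rewrite (_ : [set x : R | 0 <= x] = `[0, +oo[%classic).
    by rewrite integral0y_oneDsqr -EFinM ltry.
  by apply/seteqP; split => x /=; rewrite in_itv/= andbT.
- by move=> x; rewrite invr_ge0.
- exact: continuous_oneDsqrV.
- by move=> x; rewrite /= /oneDsqr sqrrN.
Qed.

Lemma integrable_scale (D : set R) f (c : R) : measurable D ->
  mu.-integrable D (EFin \o f) -> mu.-integrable D (EFin \o (fun x => c * f x)).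
Proof.
move=> mD intf; have := @integrableZl _ _ _ mu D mD c _ intf.
by apply: eq_integrable => // x _; rewrite /= EFinM.
Qed.

(** Comparison with C/(1+x^2). The same form of bound also gives |h| <= C, so one estimate serves
    for decay and for boundedness. *)
Lemma integrable_dominated (D : set R) h (C : R) : measurable D ->
  measurable_fun D h ->
  (forall x, D x -> `|h x| * oneDsqr x <= C) ->
  mu.-integrable D (EFin \o h).
Proof.
move=> mD mh hC; have iQ : mu.-integrable D (EFin \o (fun x : R => C * (oneDsqr
  x)^-1)).
  apply: (integrableS measurableT) => //.
  exact: integrable_scale integrable_oneDsqrV.
apply: le_integrable iQ => //; first exact/measurable_EFinP.
move=> x Dx /=; rewrite lee_fin; apply: le_trans (ler_norm _).
by rewrite ler_pdivlMr ?hC// (lt_le_trans ltr01 (oneDsqr_ge1 x)).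
Qed.

(** Continuity and decay of the function itself, a condition stable under multiplication by
    constants and powers and so inherited by y^(m-i) f(y). *)
Definition rapid phi := continuous phi /\
  forall k, exists M : R, forall x, `|x ^+ k * phi x| <= M.

Lemma rapidX phi k : rapid phi -> rapid (fun x => x ^+ k * phi x).
Proof.
move=> [cphi bphi]; split.
  by apply: continuous_funM => //; exact: exprn_continuous.
by move=> j; have [M hM] := bphi (j + k)%N; exists M => x; rewrite mulrA -exprD.
Qed.

Lemma rapidZ phi (c : R) : rapid phi -> rapid (fun x => c * phi x).
Proof.
move=> [cphi bphi]; split; first by apply: continuous_funM => // x; exact: cvg_cst.
move=> j; have [M hM] := bphi j; exists (`|c| * M) => x.
by rewrite mulrCA normrM ler_wpM2l.
Qed.

Lemma rapid_oneDsqrX phi N : rapid phi ->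
  exists C, forall x, `|phi x| * oneDsqr x ^+ N <= C.
Proof.
elim: N phi => [|N IH] phi rphi.
  have [_ /(_ 0%N)[M hM]] := rphi; exists M => x.
  by have := hM x; rewrite expr0 mul1r mulr1.
(* The extra factor 1 + x^2 is distributed: one part is the bound for phi, the other the bound for
   x^2 phi. *)
have [C1 h1] := IH _ rphi; have [C2 h2] := IH _ (rapidX 2 rphi).
exists (C1 + C2) => x; have := lerD (h1 x) (h2 x); apply: le_trans.
by rewrite exprS {1}/oneDsqr normrM normrX real_normK ?num_real// le_eqVlt;
  apply/orP; left; apply/eqP; ring.
Qed.

Lemma rapid_dominated phi : rapid phi ->
  exists C, forall x, `|phi x| * oneDsqr x <= C.
Proof. exact: (@rapid_oneDsqrX _ 1%N). Qed.

Lemma rapid_integrable phi (D : set R) : measurable D -> rapid phi ->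
  mu.-integrable D (EFin \o phi).
Proof.
move=> mD rphi; have [C hC] := rapid_dominated rphi.
apply: (integrable_dominated (C := C)) => //.
by apply: measurable_funTS; apply: continuous_measurable_fun; exact: rphi.1.
Qed.

Lemma le_normr_Rintegral_cst (A : set R) h (M : R) : measurable A ->
  (mu A < +oo)%E -> mu.-integrable A (EFin \o h) ->
  (forall x, A x -> `|h x| <= M) -> `|\int[mu]_(x in A) h x| <= M * fine (mu A).
Proof.
move=> mA muA ih hM; rewrite (le_trans (le_normr_Rintegral _ ih))//.
rewrite -Rintegral_cst//; apply: le_Rintegral => //; first exact: integrable_norm.
apply: measurable_bounded_integrable => //.
exists `|M|; split; first exact: num_real.
by move=> r /ltW Mr x _ /=.
Qed.

(** * Tail integrals, tempered kernels and primitives from -oo *)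

Definition tail_integral phi (t : R) : R := \int[mu]_(y in `]t, +oo[) phi y.

(** The integrand is bounded, by M. Besides continuity, this yields |T(t) - T(0)| <= M |t|, which
    tames the pole at 0. *)
Lemma tail_integral_lipschitz phi : rapid phi ->
  exists M, forall t s, `|tail_integral phi t - tail_integral phi s| <= M * `|t - s|.
Proof.
move=> rphi; have [_ /(_ 0%N)[M hM]] := rphi; exists M.
suff H t s : t <= s -> `|tail_integral phi t - tail_integral phi s| <= M * `|t - s|.
  move=> t s; have [/H//|/ltW/H] := leP t s.
  by rewrite distrC (distrC s).
move=> ts; have it : mu.-integrable `]t, +oo[ (EFin \o phi) by exact:
  rapid_integrable.
have -> : tail_integral phi t - tail_integral phi s = \int[mu]_(x in `]t, s]) phi x.
  by rewrite /tail_integral -(Rintegral_itvB (x :=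
    s) it)// ?bnd_simp// opprB addrCA subrr addr0.
have i1 : mu.-integrable `]t, s] (EFin \o phi) by exact: rapid_integrable.
have mts : mu `]t, s] = (s - t)%:E.
  rewrite lebesgue_measure_itv/= lte_fin; case: ltP => // st.
  by have -> : s = t; [apply/eqP; rewrite eq_le ts st|rewrite subrr].
rewrite (le_trans (le_normr_Rintegral_cst (M := M) _ _ i1 _))//.
- by rewrite mts ltry.
- by move=> x _; have := hM x; rewrite expr0 mul1r.
- by rewrite mts/= distrC ger0_norm ?subr_ge0.
Qed.

Lemma tail_integral_continuous phi : rapid phi -> continuous (tail_integral phi).
Proof.
move=> rphi; have [M hM] := tail_integral_lipschitz rphi => t.
apply/cvgrPdist_le => e e0; near=> s.
rewrite (le_trans (hM t s))// (@le_trans _ _ ((`|M| + 1) * `|t - s|))//.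
  by rewrite ler_wpM2r// (le_trans (ler_norm _))// lerDl.
have M0 : 0 < `|M| + 1 by rewrite ltr_wpDl.
rewrite mulrC -ler_pdivlMr//; near: s.
by apply: cvgr_dist_le; [exact: cvg_id|rewrite divr_gt0].
Unshelve. all: by end_near. Qed.

(* The weight makes [w t * phi y] product-integrable over [t < y] as soon as
   [phi] is rapidly decreasing. *)
Definition tempered_kernel w : Prop := continuous w /\
  exists (C : R) (N : nat), forall t y : R, t <= y ->
    `|w t| * oneDsqr t <= C * oneDsqr y ^+ N.

Definition head_integral w (y : R) : R := \int[mu]_(t in `]-oo, y]) w t.

Lemma tempered_kernel_rapid w phi : tempered_kernel w -> rapid phi ->
  exists C, forall t y, t <= y -> `|w t * phi y| <= C / oneDsqr t / oneDsqr y.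
Proof.
(* N powers of 1 + y^2 absorb the growth allowed by the kernel; one more leaves the integrable
   factor 1/(1+y^2). *)
move=> [cw [C [N wC]]] rphi; have [M hM] := rapid_oneDsqrX N.+1 rphi.
exists (C * M) => t y ty.
have C0 : 0 <= C.
  rewrite -(pmulr_lge0 _ (exprn_gt0 N (oneDsqr_gt0 t))) (le_trans _ (wC t t (lexx
    t)))//.
rewrite ler_pdivlMr ?oneDsqr_gt0// ler_pdivlMr ?oneDsqr_gt0//.
rewrite normrM; apply: le_trans (ler_wpM2l C0 (hM y)).
have := ler_wpM2r (mulr_ge0 (normr_ge0 (phi y)) (ltW (oneDsqr_gt0 y))) (wC t y ty).
have -> : `|w t| * `|phi y| * oneDsqr y * oneDsqr t =
    `|w t| * oneDsqr t * (`|phi y| * oneDsqr y) by ring.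
by move=> h; apply: (le_trans h); rewrite exprSr le_eqVlt; apply/orP; left;
  apply/eqP; ring.
Qed.


Lemma kernel_tail_integral_le phi w : tempered_kernel w -> rapid phi ->
  exists C, forall t, `|w t * tail_integral phi t| * oneDsqr t <= C.
Proof.
move=> kw rphi; have [C hC] := tempered_kernel_rapid kw rphi.
have iC t : mu.-integrable `]t, +oo[
    (EFin \o (fun y => C / oneDsqr t / oneDsqr y)).
  apply: (integrableS measurableT) => //.
  exact: integrable_scale integrable_oneDsqrV.
have iT : mu.-integrable setT (EFin \o (fun y : R => `|C| / oneDsqr y)).
  exact: integrable_scale integrable_oneDsqrV.
(* The half-line of integration is enlarged to the whole line to make the bound independent of t;
   [|C|] keeps the added part nonnegative. *)
exists (\int[mu]_y (`|C| / oneDsqr y)) => t.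
have q0 := oneDsqr_gt0 t.
have ip : mu.-integrable `]t, +oo[ (EFin \o phi) by exact: rapid_integrable.
rewrite -ler_pdivlMr// /tail_integral -RintegralZl//.
have iwp : mu.-integrable `]t, +oo[ (EFin \o (fun y => w t * phi y)).
  exact: integrable_scale.
rewrite (le_trans (le_normr_Rintegral _ iwp))//.
rewrite -RintegralZr//.
rewrite (@le_trans _ _ (\int[mu]_(y in `]t, +oo[) (C / oneDsqr t / oneDsqr y)))//.
  apply: le_Rintegral => //; first exact: integrable_norm.
  by move=> y /=; rewrite in_itv/= andbT => /ltW; exact: hC.
rewrite Rintegral_mkcond; apply: le_Rintegral => //.
- have := iC t; rewrite -(restrict_EFin) -integrable_mkcond//.
- by have := integrableZr measurableT (oneDsqr t)^-1 iT; apply: eq_integrable.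
- move=> y _; rewrite patchE; have qy := oneDsqr_gt0 y; case: ifP => _.
    rewrite mulrAC ler_wpM2r ?invr_ge0 ?(ltW q0)// ler_wpM2r ?invr_ge0 ?(ltW qy)//.
    exact: ler_norm.
  by rewrite !divr_ge0// ltW.
Qed.

Lemma kernel_tail_integrable phi w (D : set R) : measurable D ->
  tempered_kernel w -> rapid phi ->
  mu.-integrable D (EFin \o (fun t => w t * tail_integral phi t)).
Proof.
move=> mD kw rphi; have [C hC] := kernel_tail_integral_le kw rphi.
apply: (integrable_dominated (C := C)) => //.
apply: measurable_funTS; apply: continuous_measurable_fun; apply: continuous_funM.
  exact: kw.1.
exact: tail_integral_continuous.
Qed.

Lemma tempered_kernel_integrable w y : tempered_kernel w ->
  mu.-integrable `]-oo, y] (EFin \o w).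
Proof.
move=> [cw [C [N hC]]].
apply: (@integrable_dominated _ _ (C * oneDsqr y ^+ N)) => //.
  by apply: measurable_funTS; exact: continuous_measurable_fun.
by move=> x /=; rewrite in_itv/=; exact: hC.
Qed.

Lemma head_integral_derive w (y : R) : tempered_kernel w ->
  is_derive y (1 : R) (head_integral w) (w y).
Proof.
move=> kw; have [] := @continuous_FTC1 _ w -oo%O y (y + 1) _ _ _ _.
- by rewrite ltrDl.
- exact: tempered_kernel_integrable.
- exact: ltNyr.
- exact: kw.1.
- by move=> dF Fw; split; [exact: dF|rewrite -derive1E].
Qed.

Lemma smooth_head_integral w : tempered_kernel w -> smooth w ->
  smooth (head_integral w).
Proof.
by move=> kw; apply: smooth_primitive => y; exact: head_integral_derive.
Qed.

(** Both sides are iterated integrals of w(t) phi(y) over the half-plane t < y: integrating in y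
    first produces the tail of phi, in t first the primitive of w. The product bound
    [|C| / oneDsqr t / oneDsqr y] gives integrability on the plane. *)
Lemma kernel_tail_head_Fubini phi w : tempered_kernel w -> rapid phi ->
  mu.-integrable setT (EFin \o (fun y => head_integral w y * phi y)) /\
  \int[mu]_t (w t * tail_integral phi t) = \int[mu]_y (head_integral w y * phi y).
Proof.
move=> kw rphi; have [C hC] := tempered_kernel_rapid kw rphi.
pose F (z : R * R) : R := if z.1 < z.2 then w z.1 * phi z.2 else 0.
have mF : measurable_fun setT F.
  apply: measurable_fun_ifT => //.
  - by apply: measurable_fun_ltr.
  - apply: measurable_funM.
      apply: (measurableT_comp (f := w)); last exact: measurable_fst.
      by apply: continuous_measurable_fun; exact: kw.1.
    apply: (measurableT_comp (f := phi)); last exact: measurable_snd.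
    by apply: continuous_measurable_fun; exact: rphi.1.
have tailE t : (\int[mu]_y (F (t, y))%:E = (w t * tail_integral phi t)%:E)%E.
  have ip : mu.-integrable `]t, +oo[ (EFin \o phi) by exact: rapid_integrable.
  have iwp : mu.-integrable `]t, +oo[ (EFin \o (fun y => w t * phi y)).
    exact: integrable_scale.
  rewrite /tail_integral -RintegralZl// /Rintegral fineK ?integrable_fin_num//.
  rewrite [RHS]integral_mkcond; apply: eq_integral => y _.
  rewrite patchE /F/=; case: ifPn => [ty|ty].
    by rewrite mem_set//= in_itv/= ty.
  by rewrite memNset//= in_itv/= andbT; apply/negP.
have headE y : (\int[mu]_t (F (t, y))%:E = (head_integral w y * phi y)%:E)%E.
  have iw : mu.-integrable `]-oo, y] (EFin \o w) by exact: tempered_kernel_integrable.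
  have iwo : mu.-integrable `]-oo, y[ (EFin \o w).
    by apply: integrableS iw => //; apply: subset_itvl; rewrite bnd_simp.
  have iwp : mu.-integrable `]-oo, y[ (EFin \o (fun t => phi y * w t)).
    exact: integrable_scale.
  (* The slice t < y is open at y whereas [head_integral] includes y; a point has measure zero. *)
  rewrite /head_integral -Rintegral_itv_bndo_bndc// mulrC -RintegralZl//.
  rewrite /Rintegral fineK ?integrable_fin_num//.
  rewrite [RHS]integral_mkcond; apply: eq_integral => t _.
  rewrite patchE /F/=; case: ifPn => [ty|ty].
    by rewrite mem_set/= ?in_itv/= ?ty// mulrC.
  by rewrite memNset//= in_itv/=; apply/negP.
have iF : (mu \x mu)%E.-integrable setT (EFin \o F).
  pose G (z : R * R) : R := `|C| / oneDsqr z.1 * (oneDsqr z.2)^-1.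
  have mQV : measurable_fun setT (fun x : R => (oneDsqr x)^-1).
    by apply: continuous_measurable_fun; exact: continuous_oneDsqrV.
  have mG : measurable_fun setT G.
    apply: measurable_funM.
      apply: measurable_funM => //.
      by apply: (measurableT_comp (f := fun x : R => (oneDsqr x)^-1)).
    by apply: (measurableT_comp (f := fun x : R => (oneDsqr x)^-1)).
  have G0 z : 0 <= G z by rewrite mulr_ge0 ?divr_ge0 ?invr_ge0 ?(ltW (oneDsqr_gt0 _)).
  pose c := \int[mu]_y (oneDsqr y)^-1.
  have iG : (mu \x mu)%E.-integrable setT (EFin \o G).
    apply/integrable12ltyP; first exact/measurable_EFinP.
    rewrite (_ : (\int[mu]_x _)%E = (\int[mu]_x (c * `|C| * (oneDsqr x)^-1)%:E)%E).
      have := @integrable_fin_num _ _ _ mu setT _ _ (integrable_scale (c * `|C|)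
        measurableT integrable_oneDsqrV).
      by rewrite fin_numElt => /(_ measurableT)/andP[].
    apply: eq_integral => x _.
    have ix := integrable_scale (`|C| / oneDsqr x) measurableT integrable_oneDsqrV.
    rewrite -mulrA mulrC /c -RintegralZl//; last exact: integrable_oneDsqrV.
    rewrite /Rintegral fineK; last exact: (@integrable_fin_num _ _ _ mu setT).
    by apply: eq_integral => y _; rewrite /= ger0_norm.
  apply: (le_integrable _ _ _ iG) => //; first exact/measurable_EFinP.
  move=> [t y] _; rewrite /= lee_fin (ger0_norm (G0 _)) /F /G/=; case: ifPn => [ty|_].
    apply: le_trans (hC t y (ltW ty)) _.
    rewrite ler_wpM2r ?invr_ge0 ?(ltW (oneDsqr_gt0 _))//.
    by rewrite ler_wpM2r ?invr_ge0 ?(ltW (oneDsqr_gt0 _))// ler_norm.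
  by rewrite normr0; exact: (G0 (t, y)).
split.
  have mF' : measurable_fun setT (EFin \o F) by exact/measurable_EFinP.
  have -> : EFin \o (fun y => head_integral w y * phi y) = fubini_G mu (EFin \o F).
    by apply/funext => y; rewrite /fubini_G/= headE.
  have mG := @measurable_fubini_G _ _ _ _ _ mu mu _ iF.
  (* The marginal is integrable because the absolute value of an inner integral is at most the inner
     integral of |F|, whose iterated integral is finite. *)
  apply/integrableP; split; first exact: mG.
  have Flt := (@integrable21ltyP _ _ _ _ _ mu mu _ mF').1 iF; apply: le_lt_trans Flt.
  apply: ge0_le_integral => //.
  - exact: measurableT_comp.
  - apply: (measurable_fun_fubini_tonelli_G (m1 := mu) (abse \o (EFin \o F)));
    last by move=> z; exact: abse_ge0.
    by apply: measurableT_comp.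
  - move=> y _ /=; apply: le_abse_integral => //.
    exact: measurableT_comp.
rewrite /Rintegral; congr fine.
transitivity (\int[mu]_t \int[mu]_y (EFin \o F) (t, y))%E.
  by apply: eq_integral => t _; rewrite -tailE.
by rewrite (Fubini iF); apply: eq_integral => y _; rewrite -headE.
Qed.

End integrals.

(** * Principal values *)

Section principal_value.
Context {R : realType}.
Local Notation mu := (@lebesgue_measure R).
Implicit Types f g h w phi : R -> R.

Lemma oneDsqr_mono (t y : R) : 0 <= t -> t <= y -> oneDsqr t <= oneDsqr y.
Proof.
by move=> t0 ty; rewrite /oneDsqr lerD2l lerXn2r// nnegrE// (le_trans t0).
Qed.

Lemma smooth_bern_monomial i : smooth (fun t : R => bern t * (- t) ^+ i).
Proof.
apply: smoothM; first exact: smooth_bern.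
have -> : (fun t : R => (- t) ^+ i) = (fun t => ((-1) * t) ^+ i).
  by apply/funext => t; rewrite mulN1r.
apply: smoothX; apply: smoothM; [exact: smoothC|exact: smooth_id].
Qed.

Lemma bern_monomial_le i (t : R) : 0 <= t ->
  `|bern t * (- t) ^+ i| * oneDsqr t <= 2 * oneDsqr t ^+ i.+2.
Proof.
move=> t0; have q1 := oneDsqr_ge1 t.
have tq : t <= oneDsqr t by rewrite /oneDsqr; nra.
rewrite normrM normrX normrN (ger0_norm t0) (ger0_norm (ltW (bern_gt0 t))).
rewrite (_ : 2 * _ = 2 * oneDsqr t * oneDsqr t ^+ i * oneDsqr t); last first.
  by rewrite !exprS; ring.
rewrite ler_wpM2r ?(ltW (oneDsqr_gt0 t))//.
apply: ler_pM; rewrite ?exprn_ge0 ?(ltW (bern_gt0 t))//.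
  by have := bern_le1D t0; lra.
by apply: lerXn2r; rewrite ?nnegrE// ltW// oneDsqr_gt0.
Qed.

(** For t >= 0 polynomial growth in t is paid for by powers of 1 + y^2, as t <= y. For t < 0 the
    point y may be near 0, so the kernel must decay by itself, which the factor exp(-s) at t = -s
    ensures. *)
Lemma bern_tempered i : tempered_kernel (fun t : R => bern t * (- t) ^+ i).
Proof.
split; first by apply: smooth_continuous; exact: smooth_bern_monomial.
(* D bounds exp(-s) (1+s^2)^(i+2) for s >= 0: use 1+s^2 <= (1+s)^2 and (1+s)^(2(i+2)) <= (2(i+2))!
   exp(1+s). The shift to 1+s costs the factor [expR 1]. *)
pose D : R := ((i.+2).*2)`!%:R * expR 1.
exists (2 + 2 * D), i.+2 => t y ty; have qy1 := oneDsqr_ge1 y.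
have D0 : 0 <= D by rewrite mulr_ge0// expR_ge0.
have [t0|t0] := leP 0 t.
  apply: le_trans (bern_monomial_le i t0) _.
  apply: ler_pM; rewrite ?exprn_ge0 ?(ltW (oneDsqr_gt0 _))//; first lra.
  by apply: lerXn2r; rewrite ?nnegrE ?(ltW (oneDsqr_gt0 _))// oneDsqr_mono.
apply: (@le_trans _ _ (2 + 2 * D)); last first.
  by rewrite ler_peMr ?exprn_ege1//; lra.
have [s s0 ->] : exists2 s : R, 0 <= s & t = - s.
  by exists (- t); rewrite ?opprK// oppr_ge0 ltW.
have -> : oneDsqr (- s) = oneDsqr s by rewrite /oneDsqr sqrrN.
have h : `|bern s * (- - s) ^+ i| * oneDsqr s <= 2 * oneDsqr s ^+ i.+2.
  by have := bern_monomial_le i s0; rewrite opprK !normrM !normrX normrN.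
have -> : `|bern (- s) * (- - s) ^+ i| * oneDsqr s =
    expR (- s) * (`|bern s * (- - s) ^+ i| * oneDsqr s).
  by rewrite bernN_expR !normrM (ger0_norm (expR_ge0 _)) !mulrA.
apply: le_trans (ler_wpM2l (expR_ge0 _) h) _.
suff : expR (- s) * oneDsqr s ^+ i.+2 <= D by lra.
rewrite expRN mulrC ler_pdivrMr ?expR_gt0// /D -mulrA -expRD.
have := @expR_ge1Dxn R (1 + s) (i.+1).*2.+1; rewrite addr_ge0// => /(_ isT) he.
rewrite mulrC -ler_pdivrMr ?ltr0n ?fact_gt0//.
apply: le_trans he; rewrite -(doubleS i.+1).
rewrite (@le_trans _ _ ((1 + s) ^+ i.+2.*2 / i.+2.*2`!%:R))//; last by rewrite lerDr.
rewrite ler_wpM2r ?invr_ge0// -muln2 mulnC exprM.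
apply: lerXn2r; rewrite ?nnegrE ?(ltW (oneDsqr_gt0 _))// ?exprn_ge0 ?addr_ge0//.
by rewrite /oneDsqr; nra.
Qed.

(** The deleted interval has length 2e and |h| <= C on it, so the error is at most 2 C e. *)
Lemma cvg_integral_puncture h (C : R) : measurable_fun setT h ->
  (forall x, `|h x| * oneDsqr x <= C) ->
  \int[mu]_(t in [set t | e < `|t|]) h t @[e --> 0^'+] --> \int[mu]_t h t.
Proof.
move=> mh hC; have ih : mu.-integrable setT (EFin \o h).
  exact: (integrable_dominated (C := C)).
have C0 : 0 <= C by apply: le_trans (hC 0); rewrite mulr_ge0// ltW// oneDsqr_gt0.
have H e : 0 < e -> `|\int[mu]_t h t - \int[mu]_(t in [set t | e < `|t|]) h t| <=
  C * (e + e).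
  move=> e0; have setE : [set t : R | e < `|t|] = ~` `[- e, e]%classic.
    apply/seteqP; split => t /=; rewrite in_itv/= -ler_norml ltNge => /negP//.
  have mI : measurable `[- e, e]%classic by [].
  have -> : \int[mu]_t h t = \int[mu]_(t in `[- e, e]) h t +
      \int[mu]_(t in [set t | e < `|t|]) h t.
    rewrite -(setUv `[- e, e]) Rintegral_setU ?setE//.
    - exact: measurableC.
    - by rewrite setUv.
    - exact/disj_setPCl.
  have muI : mu `[- e, e]%classic = (e + e)%:E.
    by rewrite lebesgue_measure_itv/= lte_fin opprK gtrN// e0.
  rewrite addrK (le_trans (le_normr_Rintegral_cst (M := C) _ _ _ _))//.
  - by rewrite muI ltry.
  - by apply: integrableS ih.
  - move=> x _; apply: le_trans (hC x).
    by rewrite ler_peMr// oneDsqr_ge1.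
  - by rewrite muI.
have C1 : 0 < (C + 1) * 2 by rewrite mulr_gt0// ltr_wpDl.
apply/cvgrPdist_le => d d0; near=> e.
have e0 : 0 < e by near: e; exact: nbhs_right_gt.
rewrite (le_trans (H e e0))//.
rewrite (@le_trans _ _ ((C + 1) * (e + e)))//.
  by rewrite ler_wpM2r ?lerDl// addr_ge0// ltW.
rewrite (_ : (C + 1) * (e + e) = e * ((C + 1) * 2)); last by ring.
rewrite -ler_pdivlMr//; near: e.
by apply: nbhs_right_le; rewrite divr_gt0.
Unshelve. all: by end_near. Qed.

Lemma integral_odd (A : set R) h : measurable A -> -%R @^-1` A = A ->
  measurable_fun setT h ->
  mu.-integrable A (EFin \o h) -> (forall x, h (- x) = - h x) ->
  \int[mu]_(x in A) h x = 0.
Proof.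
move=> mA NA mh ih hN.
have e2 : \int[mu]_(x in A) h (- x) = - \int[mu]_(x in A) h x.
  under eq_Rintegral do rewrite hN -mulN1r.
  by rewrite RintegralZl// mulN1r.
have e1 : \int[mu]_(x in A) h x = \int[mu]_(x in A) h (- x).
  rewrite /Rintegral; congr fine.
  transitivity (\int[pushforward mu (-%R : _ ->
    measurableTypeR R)]_(x in A) (h x)%:E)%E.
    by apply: eq_measure_integral => //= B mB _; rewrite lebesgue_measureN.
  rewrite (@integral_pushforward _ _ _ _ _ (-%R : measurableTypeR R ->
    measurableTypeR R))//= ?NA//.
    exact/measurable_EFinP.
  have := integrable_scale (-1) mA ih; apply: eq_integrable => // x _.
  by rewrite /= hN mulN1r.
by have /eqP := e1; rewrite e2 -addr_eq0 -mulr2n mulrn_eq0/= => /eqP.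
Qed.

(** Inversion is continuous off 0, and its conventional value at 0 is 0; the two pieces are glued
    along a measurable set. *)
Lemma measurable_inv : measurable_fun setT (@GRing.inv R).
Proof.
rewrite (_ : @GRing.inv R = fun x => if x != 0 then x^-1 else 0); last first.
  by apply/funext => x; case: eqVneq => [->|//]; rewrite invr0.
apply: measurable_fun_if => //.
- apply: (measurable_fun_bool true).
  rewrite setTI (_ : _ @^-1` _ = ~` [set 0]); first by apply: measurableC.
  by apply/seteqP; split => x /=; [move/eqP|move=> ?; apply/eqP].
- rewrite setTI (_ : _ @^-1` _ = ~` [set 0]).
    apply: open_continuous_measurable_fun.
      by rewrite openC; exact: closed_eq.
    move=> x; rewrite inE/= => /eqP x0; exact: inv_continuous.
  by apply/seteqP; split => x /=; [move/eqP|move=> ?; apply/eqP].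
Qed.

Definition pole (t : R) : R := (expR (- t) - 1)^-1.

Lemma poleE t : t != 0 -> pole t = - (bern t / t).
Proof.
move=> t0; rewrite bernE// /pole -opprB invrN mulrAC divff// mul1r.
by [].
Qed.

Lemma measurable_pole : measurable_fun setT pole.
Proof.
apply: (measurableT_comp (f := @GRing.inv R)); first exact: measurable_inv.
apply: measurable_funB => //; apply: (measurableT_comp (f := @expR R)) => //.
Qed.

Lemma open_puncture (e : R) : open [set t : R | e < `|t|].
Proof.
rewrite (_ : [set t : R | e < `|t|] = Num.norm @^-1` [set x | e < x])//.
by apply: open_comp; [move=> x _; exact: norm_continuous|exact: open_gt].
Qed.

Lemma measurable_puncture (e : R) : measurable [set t : R | e < `|t|].
Proof. by apply: open_measurable; exact: open_puncture. Qed.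

(** With c = T(0), the odd function o(t) = c/((1+t^2) t) carries the whole singularity, and K T = U
    - o. Its integral over |t| > e is 0; the factor 1+t^2 makes it integrable there. The remainder U
    is bounded near 0 and decays, so its punctured integrals converge. *)
Lemma cvg_principal_value phi : rapid phi ->
  cvg (\int[mu]_(t in [set t | e < `|t|]) (pole t * tail_integral phi t) @[e -->
    0^'+]).
Proof.
move=> rphi; pose c := tail_integral phi 0.
pose U t := (c / oneDsqr t - bern t * tail_integral phi t) / t.
pose o t := c / oneDsqr t / t.
have [C1 hC1] := kernel_tail_integral_le (bern_tempered 0) rphi.
have [M hM] := tail_integral_lipschitz rphi.
have mQ : measurable_fun setT (fun t : R => c / oneDsqr t).
  apply: measurable_funM => //; apply: continuous_measurable_fun.
  exact: continuous_oneDsqrV.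
have cbt : continuous (fun t : R => bern t * tail_integral phi t).
  apply: continuous_funM; last exact: tail_integral_continuous.
  exact/smooth_continuous/smooth_bern.
have mo : measurable_fun setT o by apply: measurable_funM => //;
  exact: measurable_inv.
have mU : measurable_fun setT U.
  apply: measurable_funM; last exact: measurable_inv.
  apply: measurable_funB => //; exact: continuous_measurable_fun cbt.
have UC : exists C, forall t, `|U t| * oneDsqr t <= C.
  have M0 : 0 <= M by have := hM 1 0; rewrite subr0 normr1 mulr1; exact: le_trans.
  have C10 : 0 <= C1.
    by apply: le_trans (hC1 0); rewrite mulr_ge0// ltW// oneDsqr_gt0.
  (* [|c| + C1] handles |t| >= 1. For |t| < 1 the quotient is at most 2|c| + 2M and 1+t^2 is at most
     2. *)
  exists (`|c| + C1 + 2 * (2 * `|c| + 2 * M)) => t.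
  have q0 := oneDsqr_gt0 t; have qt : oneDsqr t != 0 by rewrite gt_eqF.
  have [t1|t1] := leP 1 `|t|.
    have t0 : 0 < `|t| by exact: lt_le_trans t1.
    rewrite /U normrM normfV mulrAC ler_pdivrMr//.
    have h : `|c / oneDsqr t - bern t * tail_integral phi t| * oneDsqr t <= `|c| + C1.
      apply: le_trans (ler_wpM2r (ltW q0) (ler_normB _ _)) _.
      rewrite mulrDl normrM normfV (gtr0_norm q0) divfK//.
      by have := hC1 t; rewrite expr0 mulr1 lerD2l.
    apply: le_trans h _; have c0 := normr_ge0 c; nra.
  have [->|t0] := eqVneq t 0.
    rewrite /U invr0 mulr0 normr0 mul0r; have c0 := normr_ge0 c; lra.
  have tn0 : 0 < `|t| by rewrite normr_gt0.
  have q2 : oneDsqr t <= 2.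
    rewrite /oneDsqr -real_normK ?num_real//; nra.
  (* Each of the three pieces is O(t): t^2/(1+t^2), b(t) - 1 times a bounded tail, and T(t) -
     T(0). *)
  rewrite /U; have -> : c / oneDsqr t - bern t * tail_integral phi t =
    - (c * (t ^+ 2 / oneDsqr t)) -
      ((bern t - 1) * tail_integral phi t + (tail_integral phi t - c)).
    by move: qt; rewrite /oneDsqr => qt; field.
  set b := _ - (_ + _); suff hb : `|b| <= (2 * `|c| + 2 * M) * `|t|.
    have {}hb : `|b / t| <= 2 * `|c| + 2 * M by rewrite normrM normfV ler_pdivrMr.
    have b0 := normr_ge0 (b / t); have c0 := normr_ge0 c; nra.
  have ht : `|tail_integral phi t| <= `|c| + M.
    rewrite -[tail_integral phi t](subrK c) addrC (le_trans (ler_normD _ _))// lerD2l.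
    by have := hM t 0; rewrite subr0 => /le_trans; apply; nra.
  have h1 : `|c * (t ^+ 2 / oneDsqr t)| <= `|c| * `|t|.
    rewrite normrM ler_wpM2l// normrM normfV (gtr0_norm q0) ler_pdivrMr// normrX.
    by have := oneDsqr_ge1 t; nra.
  have h2 : `|(bern t - 1) * tail_integral phi t| <= `|t| * (`|c| + M).
    by rewrite normrM; apply: ler_pM => //; exact: bern_sub1_le.
  have h3 : `|tail_integral phi t - c| <= M * `|t| by have := hM t 0; rewrite subr0.
  rewrite /b; apply: le_trans (ler_normB _ _) _; rewrite normrN.
  have := ler_normD ((bern t - 1) * tail_integral phi t) (tail_integral phi t - c);
    nra.
have [C hC] := UC.
apply/cvg_ex; exists (\int[mu]_t U t).
have := cvg_integral_puncture mU hC; apply: cvg_trans; apply: near_eq_cvg.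
near=> e; have e0 : 0 < e by near: e; exact: nbhs_right_gt.
set A := [set t | e < `|t|].
have mA : measurable A by exact: measurable_puncture.
have io : mu.-integrable A (EFin \o o).
  apply: (@integrable_dominated _ _ _ (`|c| / e)) => //;
    first exact: measurable_funTS.
  move=> x; rewrite /A /o/= => ex; have q0 := oneDsqr_gt0 x.
  rewrite !normrM !normfV (gtr0_norm q0) mulrAC divfK ?gt_eqF//.
  have x0 : 0 < `|x| by exact: lt_trans ex.
  by rewrite ler_wpM2l// lef_pV2 ?posrE// ltW.
have iU : mu.-integrable A (EFin \o U).
  by apply: (integrable_dominated (C := C)) => //; exact: measurable_funTS.
have -> : \int[mu]_(t in A) (pole t * tail_integral phi t) =
    \int[mu]_(t in A) U t - \int[mu]_(t in A) o t.
  rewrite -RintegralB//; apply: eq_Rintegral => t; rewrite inE/= => et.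
  have t0 : t != 0 by rewrite -normr_gt0 (lt_trans e0).
  by rewrite poleE// /U /o; ring.
rewrite [X in _ - X]integral_odd ?subr0//.
- by apply/seteqP; split => t; rewrite /A/= normrN.
- by move=> x; rewrite /o /oneDsqr sqrrN invrN mulrN.
Unshelve. all: by end_near. Qed.

End principal_value.

(** * Vanishing of the singular coefficient *)

Section expansion.
Context {R : realType}.
Implicit Types (f g S : R -> R) (a : R^nat) (p : {poly R}).

(** The neighbourhood is punctured because the Bernoulli hypothesis says nothing at 0 and because
    expansions get divided by x. *)
Definition bigO0 n f : Prop :=
  exists M : R, \forall x \near (0 : R)^', `|f x| <= M * `|x| ^+ n.

Lemma bigO0_eq n f g : (\forall x \near (0 : R)^', f x = g x) ->
  bigO0 n f -> bigO0 n g.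
Proof. by move=> fg [M hM]; exists M; apply: filterS2 fg hM => x ->. Qed.

Lemma bigO0D n f g : bigO0 n f -> bigO0 n g -> bigO0 n (fun x => f x + g x).
Proof.
move=> [M hM] [N hN]; exists (M + N); apply: filterS2 hM hN => x h1 h2.
by rewrite mulrDl (le_trans (ler_normD _ _))// lerD.
Qed.

Lemma bigO0M m n f g : bigO0 m f -> bigO0 n g ->
  bigO0 (m + n) (fun x => f x * g x).
Proof.
move=> [M hM] [N hN]; exists (M * N); apply: filterS2 hM hN => x h1 h2.
by rewrite normrM exprD mulrACA ler_pM.
Qed.

Lemma bigO0_cvg f (l : R) : f x @[x --> (0 : R)^'] --> l -> bigO0 0 f.
Proof.
move=> /cvgrPdist_le /(_ 1 ltr01) h; exists (`|l| + 1); apply: filterS h => x h.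
by rewrite expr0 mulr1 -[f x](subrK l) addrC (le_trans (ler_normD _ _))// lerD2l
  distrC.
Qed.

Lemma cvg_horner0 p : (p.[x] : R) @[x --> (0 : R)^'] --> (p.[0] : R).
Proof. by apply: cvg_within_filter; exact: continuous_horner. Qed.

Lemma bigO0_horner p : bigO0 0 (fun x => p.[x]).
Proof. by apply: bigO0_cvg; exact: cvg_horner0. Qed.

Lemma bigO0_exprn n : bigO0 n (fun x => x ^+ n).
Proof. by exists 1; apply: nearW => x; rewrite mul1r normrX. Qed.

Lemma bigO0N n f : bigO0 n f -> bigO0 n (fun x => f (- x)).
Proof.
move=> [M hM]; exists M; have /nbhs_ballP[r/= r0 hr] := hM.
apply/nbhs_ballP; exists r => //= x xr x0; rewrite -[`|x|]normrN.
by apply: hr; rewrite /= ?oppr_eq0//; move: xr; rewrite /ball/= !sub0r !normrN.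
Qed.

(** For n > 0 the bound forces p(0) = 0, and dividing by X lowers both the size and the order of
    vanishing by one. *)
Lemma bigO0_poly_eq0 n p : (size p <= n)%N -> bigO0 n (fun x => p.[x]) -> p = 0.
Proof.
elim: n p => [|n IH] p sp [M hM].
  by apply/eqP; rewrite -size_poly_leq0.
have p0 : p.[0] = 0.
  suff h : p.[x] @[x --> (0 : R)^'] --> (0 : R).
    exact: (cvg_unique (@Rhausdorff R) (@cvg_horner0 p) h).
  apply/cvgr0Pnorm_le => e e0.
  have M1 : 0 < `|M| + 1 by rewrite ltr_wpDl.
  have x1 : \forall x \near (0 : R)^', `|x| <= 1 by exact: dnbhs0_le.
  have x2 : \forall x \near (0 : R)^', `|x| <= e / (`|M| + 1).
    by apply: dnbhs0_le; rewrite divr_gt0.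
  apply: filterS3 hM x1 x2 => x h1 h2 h3; apply: le_trans h1 _.
  move: h3; rewrite ler_pdivlMr// => h3; apply: le_trans h3; rewrite exprS mulrCA.
  rewrite ler_wpM2l// (@le_trans _ _ (`|M| * `|x| ^+ n))//.
    by rewrite ler_wpM2r ?exprn_ge0// ler_norm.
  rewrite (@le_trans _ _ `|M|)//; last by rewrite lerDl.
  by rewrite ler_piMr// exprn_ile1.
have /factor_theorem[q pq] : root p 0 by apply/rootP.
suff q0 : q = 0 by rewrite pq q0 mul0r.
apply: IH; last first.
  exists M; have /nbhs_ballP[r/= r0 hr] := hM.
  apply/nbhs_ballP; exists r => //= x xr x0.
  have := hr x xr x0; rewrite pq hornerM hornerXsubC subr0 normrM exprSr mulrA.
  by rewrite ler_pM2r// normr_gt0.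
have [->|q0] := eqVneq q 0; first by rewrite size_poly0.
by move: sp; rewrite pq size_Mmonic ?monicXsubC// size_XsubC addn2.
Qed.

Definition power_expansion a S : Prop :=
  \forall x \near (0 : R)^', series (fun k => a k * x ^+ k) @ \oo --> S x.

(** Convergence at the single point r/2 gives absolute convergence at r/4, whose sum bounds S
    uniformly for |x| < r/4. *)
Lemma power_expansion_bigO0 a S : power_expansion a S -> bigO0 0 S.
Proof.
move=> /nbhs_ballP[r/= r0 hr].
have cr : cvgn (pseries a (r / 2)).
  apply/cvg_ex; exists (S (r / 2)); apply: hr.
    by rewrite /ball/= sub0r normrN gtr0_norm ?divr_gt0//; lra.
  by rewrite /= gt_eqF// divr_gt0.
have cn : cvgn (series (fun k => `|a k| * (r / 4) ^+ k)).
  have := @is_cvg_pseries_inside_norm _ _ (r / 2) (r / 4) cr.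
  by rewrite !gtr0_norm ?divr_gt0//; apply; lra.
exists (limn (series (fun k => `|a k| * (r / 4) ^+ k))).
apply/nbhs_ballP; exists (r / 4) => /=; first by rewrite divr_gt0.
move=> x; rewrite /ball/= sub0r normrN expr0 mulr1 => xr x0.
have cS : series (fun k => a k * x ^+ k) @ \oo --> S x.
  by apply: hr => //; rewrite /ball/= sub0r normrN (lt_trans xr)//; lra.
have cnx : cvgn [normed series (fun k => a k * x ^+ k)].
  have r4 k : 0 <= (r / 4) ^+ k by rewrite exprn_ge0// ltW// divr_gt0.
  apply: (series_le_cvg _ _ _ cn) => k /=; [by []|exact: mulr_ge0|].
  by rewrite normrM normrX ler_wpM2l// lerXn2r ?nnegrE ?(ltW xr)// ltW// divr_gt0.
rewrite -(cvg_lim _ cS)// (le_trans (lim_series_norm cnx))//.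
apply: lim_series_le => // k /=.
by rewrite normrM normrX ler_wpM2l// lerXn2r ?nnegrE ?(ltW xr)// ltW// divr_gt0.
Qed.

Lemma power_expansion_shift a S : power_expansion a S ->
  power_expansion (fun k => a k.+1) (fun x => (S x - a 0%N) / x).
Proof.
move=> /nbhs_ballP[r/= r0 hr]; apply/nbhs_ballP; exists r => //= x xr x0.
have h : series (fun k => a k * x ^+ k) n.+1 @[n --> \oo] --> S x.
  by rewrite (cvg_shiftS (series (fun k => a k * x ^+ k))); exact: hr.
rewrite (_ : series _ = (fun n => (series (fun k => a k * x ^+ k) n.+1 - a 0%N) / x)).
  by apply: cvgM; [apply: cvgB => //; exact: cvg_cst|exact: cvg_cst].
apply/funext => n; rewrite /series/= big_nat_recl//= expr0 mulr1 addrC addKr.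
by rewrite mulr_suml; apply: eq_bigr => k _; rewrite exprSr mulrA mulfK.
Qed.

(** The remainder of order n+1 is x times the remainder of order n of the shifted series, so
    boundedness of S is all that the induction starts from. *)
Lemma power_expansion_poly a S n : power_expansion a S ->
  bigO0 n (fun x => S x - (\poly_(k < n) a k).[x]).
Proof.
elim: n a S => [|n IH] a S h.
  apply: bigO0_eq (power_expansion_bigO0 h); apply: nearW => x.
  by rewrite horner_poly big_ord0 subr0.
have [M hM] := IH _ _ (power_expansion_shift h); exists M.
have /nbhs_ballP[r/= r0 hr] := hM.
apply/nbhs_ballP; exists r => //= x xr x0.
have := hr x xr x0; rewrite -(ler_pM2r (x := `|x|)) ?normr_gt0//.
rewrite -normrM mulrBl divfK// -mulrA -exprSr; congr (`|_| <= _).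
rewrite !horner_poly big_ord_recl/= expr0 mulr1 opprD addrA; congr (_ - _).
by rewrite mulr_suml; apply: eq_bigr => k _; rewrite exprSr mulrA.
Qed.

Lemma power_expansion_expR : power_expansion (fun k => k`!%:R^-1) expR.
Proof.
apply: nearW => x; rewrite (_ : (fun k => _) = exp_coeff x).
  exact: is_cvg_series_exp_coeff.
by apply/funext => k; rewrite /exp_coeff/= mulrC.
Qed.

Lemma bernoulli_expansion (B : nat -> R) : bernoulli_numbers B ->
  power_expansion (fun k => B k * (-2) ^+ k / k`!%:R) (fun x => bern (- 2 * x)).
Proof.
(* The radius is halved so that -2x stays where the generating series converges. *)
move=> /nbhs_ballP[r/= r0 hr]; apply/nbhs_ballP; exists (r / 2) => /=.
  by rewrite divr_gt0.
move=> x; rewrite /ball/= sub0r normrN => xr x0.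
have x20 : - 2 * x != 0 by rewrite mulf_neq0// oppr_eq0.
have x2r : ball 0 r (- 2 * x).
  have -> : - 2 * x = - (2 * x) by rewrite mulNr.
  rewrite /ball/= sub0r opprK normrM (ger0_norm (ler0n R 2)).
  by rewrite mulrC -ltr_pdivlMr.
have /= := hr _ x2r x20; rewrite -bernE//.
rewrite (_ : (fun k => B k * (-2) ^+ k / k`!%:R * x ^+ k) =
  (fun k => B k * ((- 2 * x) ^+ k / k`!%:R)))//.
by apply/funext => k; rewrite exprMn; ring.
Qed.

(* [bern (- 2 * x) * expR x] equals [x / sinh x] away from 0, an even function. *)
Lemma bern_expR_even (x : R) :
  bern (- 2 * x) * expR x = bern (- 2 * - x) * expR (- x).
Proof.
rewrite mulrN !mulNr opprK bernN_expR mulrAC -expRD.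
by rewrite (_ : - (2 * x) + x = - x) ?(mulrC (expR _))//; ring.
Qed.

(** The sum is the coefficient of X^(n-1) in c, the product of the two truncations cut at X^n. As c
    agrees modulo O(x^n) with an even function, c(x) - c(-x) is a polynomial of size at most n that
    is O(x^n), hence 0; since n - 1 is odd, twice the sum vanishes. *)
Lemma bernoulli_sum_eq0 (B : nat -> R) (n : nat) : bernoulli_numbers B ->
  (0 < n)%N -> ~~ odd n ->
  \sum_(k < n) B k * (-2) ^+ k / k`!%:R / (n - k.+1)`!%:R = 0.
Proof.
move=> hB n0 nodd; pose a k := B k * (-2) ^+ k / k`!%:R.
pose pa : {poly R} := \poly_(k < n) a k.
pose pe : {poly R} := \poly_(k < n) k`!%:R^-1.
pose c := take_poly n (pa * pe).
have Oa := power_expansion_poly n (bernoulli_expansion hB).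
have Oe := power_expansion_poly n power_expansion_expR.
have Oc : bigO0 n (fun x => bern (- 2 * x) * expR x - c.[x]).
  have E0 : bigO0 0 expR := power_expansion_bigO0 power_expansion_expR.
  (* Three errors make up the difference: truncating b(-2x), truncating exp, and cutting the product
     at X^n. *)
  have h1 := bigO0M Oa E0; rewrite addn0 in h1.
  have h2 := bigO0M (bigO0_horner pa) Oe.
  have h3 := bigO0M (bigO0_exprn n) (bigO0_horner (drop_poly n (pa * pe))).
  rewrite addn0 in h3; apply: bigO0_eq (bigO0D (bigO0D h1 h2) h3).
  apply: nearW => x; rewrite -/pa -/pe.
  have : (pa * pe).[x] = c.[x] + (drop_poly n (pa * pe)).[x] * x ^+ n.
    by rewrite -{1}(poly_take_drop n (pa * pe)) hornerD hornerM hornerXn.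
  rewrite hornerM => h; rewrite -/a; ring: h.
pose d : {poly R} := \poly_(k < n) (c`_k * (1 - (-1) ^+ k)).
have d0 : d = 0.
  apply: (bigO0_poly_eq0 (size_poly _ _)).
  have ON := bigO0N Oc.
  have O1 : bigO0 0 (fun=> - 1 : R) by apply: bigO0_cvg; exact: cvg_cst.
  have := bigO0M O1 Oc; rewrite add0n => Oc'.
  apply: bigO0_eq (bigO0D ON Oc').
  apply: nearW => x; rewrite -bern_expR_even.
  have hc y : c.[y] = \sum_(k < n) c`_k * y ^+ k.
    by rewrite (horner_coef_wide _ (size_take_poly _ _)).
  rewrite horner_poly (_ : \sum_(k < n) _ = c.[x] - c.[- x]); first by ring.
  rewrite !hc -sumrB; apply: eq_bigr => k _.
  by rewrite [(- x) ^+ _]exprNn; ring.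
have /eqP : d`_n.-1 = 0 by rewrite d0 coef0.
rewrite coef_poly prednK// leqnn -signr_odd.
have -> : odd n.-1 by rewrite -(prednK n0) /= negbK in nodd.
rewrite expr1 mulf_eq0 opprK (_ : (1 + 1 == 0 :> R) = false) ?orbF; last first.
  by rewrite (_ : 1 + 1 = 2%:R) ?pnatr_eq0//.
rewrite coef_take_poly prednK// leqnn coefM prednK// => /eqP h.
rewrite -[RHS]h; apply: eq_bigr => k _; rewrite !coef_poly ltn_ord.
have -> : (n.-1 - k < n)%N by rewrite (leq_ltn_trans (leq_subr _ _))// prednK.
by rewrite /a -subn1 -subnDA add1n.
Qed.

End expansion.

(** * Reduction to real integrals *)

Section linear_combinations.
Context {R : realType}.
Local Notation mu := (@lebesgue_measure R).

Lemma Rintegral_lincomb (D : set R) (n : nat) (c : nat -> R) (h : nat -> R -> R) :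
  measurable D -> (forall i, (i < n)%N -> mu.-integrable D (EFin \o h i)) ->
  mu.-integrable D (EFin \o (fun x => \sum_(i < n) c i * h i x)) /\
  \int[mu]_(x in D) (\sum_(i < n) c i * h i x) =
  \sum_(i < n) c i * \int[mu]_(x in D) h i x.
Proof.
move=> mD; elim: n => [|n IH] ih.
  have e0 x : \sum_(i < 0) c i * h i x = 0 by rewrite big_ord0.
  split; last by under eq_Rintegral do rewrite e0;
    rewrite big_ord0 Rintegral_cst ?mul0r.
  by have := @integrable0 _ _ _ mu D; apply: eq_integrable => // x _; rewrite /= e0.
have [i1 e1] := IH (fun i hi => ih i (ltnW hi)).
have i2 := integrable_scale (c n) mD (ih n (ltnSn n)).
have eS x : \sum_(i < n.+1) c i * h i x = \sum_(i < n) c i * h i x + c n * h n x.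
  by rewrite big_ord_recr.
split.
  have := @integrableD _ _ _ mu _ mD _ _ i1 i2; apply: eq_integrable => // x _.
  by rewrite /= eS EFinD.
under eq_Rintegral do rewrite eS.
by rewrite RintegralD// e1 RintegralZl ?ih// big_ord_recr.
Qed.

Lemma cvg_lincomb (F : set_system R) {FF : Filter F} (n : nat) (c : nat -> R)
    (h : nat -> R -> R) (l : nat -> R) :
  (forall i, (i < n)%N -> h i x @[x --> F] --> l i) ->
  (\sum_(i < n) c i * h i x) @[x --> F] --> \sum_(i < n) c i * l i.
Proof.
elim: n => [|n IH] hl.
  rewrite big_ord0 (_ : (fun x => _) = (fun=> 0)); first exact: cvg_cst.
  by apply/funext => x; rewrite big_ord0.
rewrite big_ord_recr (_ : (fun x => _) =
    (fun x => \sum_(i < n) c i * h i x + c n * h n x)); last first.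
  by apply/funext => x; rewrite big_ord_recr.
apply: cvgD; first by apply: IH => i /ltnW; exact: hl.
by apply: cvgM; [exact: cvg_cst|exact: hl].
Qed.

End linear_combinations.

(** * Euler's integral at the positive integers *)

Section gamma.
Context {R : realType}.
Local Notation mu := (@lebesgue_measure R).

Lemma cvgy_exprn_expRN k : (x : R) ^+ k * expR (- x) @[x --> +oo] --> (0 : R).
Proof.
apply: (@squeeze_cvgr _ _ _ _ (fun=> 0) (fun x => k.+1`!%:R * x^-1)).
- near=> x; have x0 : 0 < x by near: x; exact: nbhs_pinfty_gt.
  rewrite mulr_ge0 ?exprn_ge0 ?expR_ge0 ?(ltW x0)//=.
  rewrite expRN ler_pdivrMr ?expR_gt0// mulrAC ler_pdivlMr// -exprSr.
  rewrite mulrC -ler_pdivrMr ?ltr0n ?fact_gt0//.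
  by have := expR_ge1Dxn k (ltW x0); lra.
- exact: cvg_cst.
- rewrite -(mulr0 k.+1`!%:R); apply: cvgM; first exact: cvg_cst.
  by apply/gtr0_cvgV0; [exact: nbhs_pinfty_gt|exact: cvg_id].
Unshelve. all: by end_near. Qed.

Lemma Rintegral_exprn_expRN m :
  \int[mu]_(t in [set t : R | 0 < t]) (t ^+ m * expR (- t)) = m`!%:R.
Proof.
(* Integration by parts at the level of primitives: (m+1) F(t) - t^(m+1) exp(-t) is the next F. As F
   vanishes at +oo, the integral is -F(0). *)
have [F [F0 Fy dF]] : exists F : R -> R, [/\ F 0 = - m`!%:R,
    F x @[x --> +oo] --> (0 : R) &
    forall t : R, is_derive t (1 : R) F (t ^+ m * expR (- t))].
  have dE (t : R) : is_derive t (1 : R) (fun t => expR (- t)) (- expR (- t)).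
    by rewrite -mulN1r mulrC; apply: is_derive1_comp.
  elim: m => [|m [F [F0 Fy dF]]].
    exists (fun t => - expR (- t)); split.
    - by rewrite oppr0 expR0.
    - by rewrite -oppr0; apply: cvgN; exact: cvgr_expR.
    - by move=> t; rewrite expr0 mul1r -[X in is_derive _ _ _ X]opprK;
      exact: is_deriveN.
  exists (fun t => m.+1%:R * F t - t ^+ m.+1 * expR (- t)); split.
  - by rewrite F0 expr0n mul0r subr0 factS natrM mulrN.
  - rewrite -(subr0 (0 : R)) -[X in X - _](mulr0 m.+1%:R); apply: cvgB.
      by apply: cvgM; [exact: cvg_cst|exact: Fy].
    exact: cvgy_exprn_expRN.
  - move=> t; have dX : is_derive t (1 : R) (fun t : R => t ^+ m.+1) (m.+1%:R * t ^+
    m).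
      have := @is_deriveX _ _ id m.+1 t 1 1 (is_derive_id t 1).
      by rewrite exprfctE /GRing.scale/= mulr1.
    have := is_deriveB (is_deriveM (is_derive_cst (m.+1%:R : R) t 1) (dF t))
      (is_deriveM dX (dE t)).
    by rewrite /GRing.scale/= mulr0 addr0 => h; apply: is_derive_eq; rewrite ?exprS;
      ring.
have cf : continuous (fun t : R => t ^+ m * expR (- t)).
  apply: continuous_funM; first exact: exprn_continuous.
  by move=> t; apply: (cvg_comp -%R expR);
    [exact: opp_continuous|exact: continuous_expR].
rewrite (_ : [set t | 0 < t] = `]0, +oo[%classic); last first.
  by apply/seteqP; split => t /=; rewrite in_itv/= andbT.
have Fc : continuous F.
  by move=> t; apply: differentiable_continuous; apply/derivable1_diffP; case: (dF t).
have -> : \int[mu]_(t in `]0, +oo[) (t ^+ m * expR (- t)) =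
    \int[mu]_(t in `[0, +oo[) (t ^+ m * expR (- t)).
  rewrite /Rintegral integral_itv_obnd_cbnd//; apply/measurable_EFinP.
  by apply: measurable_funTS; exact: continuous_measurable_fun cf.
rewrite (Rintegral_ge0_continuous_FTC2y _ _ Fy).
- by rewrite F0 sub0r opprK.
- by move=> x x0; rewrite mulr_ge0 ?exprn_ge0 ?expR_ge0.
- exact: continuous_subspaceT.
- by move=> x _; case: (dF x).
- by apply: cvg_within_filter; exact: Fc.
- by move=> x _; rewrite derive1E derive_val.
Qed.

End gamma.

Local Open Scope complex_scope.

(** * Separation of real and imaginary parts *)

Section reduction_to_reals.
Context {R : realType}.
Local Notation mu := (@lebesgue_measure R).
Implicit Types (f : R -> R[i]) (q : R -> R).

Lemma natr_complex m : (m%:R : R[i]) = (m%:R : R)%:C.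
Proof. by rewrite -(rmorph_nat (real_complex R)). Qed.

Lemma cpow_nat m (t : R) : 0 < t -> cpow t (m.+1%:R - 1) = (t ^+ m)%:C.
Proof.
move=> t0; rewrite -natr1 addrK natr_complex /cpow/= mul0r cos0 sin0.
rewrite expRM_natl lnK ?posrE//.
by rewrite -[RHS]mulr1; congr (_ * _).
Qed.

Lemma Re_realM (a : R) (z : R[i]) : complex.Re (a%:C * z) = a * complex.Re z.
Proof. by case: z => x y /=; rewrite mul0r subr0. Qed.

Lemma Im_realM (a : R) (z : R[i]) : complex.Im (a%:C * z) = a * complex.Im z.
Proof. by case: z => x y /=; rewrite mul0r addr0. Qed.

Lemma Gamma_nat m : Gamma (m.+1%:R : R[i]) = (m`!%:R)%:C.
Proof.
have E (t : R) : t \in [set t : R | 0 < t] ->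
    cpow t (m.+1%:R - 1) * (expR (- t))%:C = (t ^+ m * expR (- t))%:C.
  by rewrite inE/= => t0; rewrite cpow_nat// -rmorphM.
rewrite /Gamma /cintegral -Rintegral_exprn_expRN; congr (_ +i* _).
  by apply: eq_Rintegral => t /E ->.
rewrite (@eq_Rintegral _ _ _ _ _ (fun=> 0)); last by move=> t /E ->.
by rewrite Rintegral_cst ?mul0r//; exact: open_measurable (@open_gt _ 0).
Qed.

(** The index m stands for s = m + 1, so that s - 1 is m and Gamma(s) is m!. Hence n - k becomes
    [n - k.+1] from here on. *)
Definition gamma_density m (x : R) : R := if 0 < x then x ^+ m / m`!%:R else 0.

Lemma gamma_plus_nat m f : gamma_plus m.+1%:R f =
  (\int[mu]_x (gamma_density m x * complex.Re (f x))) +i*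
  (\int[mu]_x (gamma_density m x * complex.Im (f x))).
Proof.
rewrite /gamma_plus /regular /cintegral.
have E (x : R) : (if 0 < x then cpow x (m.+1%:R - 1) / Gamma m.+1%:R else 0) =
    (gamma_density m x)%:C.
  rewrite /gamma_density; case: ifP => // x0.
  by rewrite cpow_nat// Gamma_nat -fmorphV -rmorphM.
by congr (_ +i* _); apply: eq_Rintegral => x _; rewrite E ?Re_realM ?Im_realM.
Qed.

Definition li_real m q : R :=
  lim (\int[mu]_(t in [set t | e < `|t|])
    (pole t * \int[mu]_x (gamma_density m x * q (x + t))) @[e --> 0^'+]).

Lemma li_nat m f : li m.+1%:R f =
  li_real m (fun x => complex.Re (f x)) +i* li_real m (fun x => complex.Im (f x)).
Proof.
pose F (e : R) := cintegral [set t : R | e < `|t|] (fun t =>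
  ((expR (- t) - 1)^-1)%:C * gamma_plus m.+1%:R (fun x => f (x + t))).
have ReF : (fun e => complex.Re (F e)) = (fun e => \int[mu]_(t in [set t | e < `|t|])
    (pole t * \int[mu]_x (gamma_density m x * complex.Re (f (x + t))))).
  by apply/funext => e; apply: eq_Rintegral => t _; rewrite Re_realM gamma_plus_nat.
have ImF : (fun e => complex.Im (F e)) = (fun e => \int[mu]_(t in [set t | e < `|t|])
    (pole t * \int[mu]_x (gamma_density m x * complex.Im (f (x + t))))).
  by apply/funext => e; apply: eq_Rintegral => t _; rewrite Im_realM gamma_plus_nat.
by rewrite /li_real -ReF -ImF.
Qed.

Definition lambda_real (B : nat -> R) n q : R :=
  \sum_(k < n) li_real (n - k.+1)
    (fun x => B k * ((- 2 * x) ^+ k / k`!%:R) * q x).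

Lemma complex_sum n (F G : nat -> R) : \sum_(k < n) (F k +i* G k) =
  (\sum_(k < n) F k) +i* (\sum_(k < n) G k).
Proof.
elim: n => [|n IH]; first by rewrite !big_ord0.
by rewrite !big_ord_recr/= IH.
Qed.

Lemma lambda_iE (B : nat -> R) n f : lambda_i B n f =
  lambda_real B n (fun x => complex.Re (f x)) +i*
  lambda_real B n (fun x => complex.Im (f x)).
Proof.
pose p k (x : R) := B k * ((- 2 * x) ^+ k / k`!%:R).
pose F k := li_real (n - k.+1) (fun x => p k x * complex.Re (f x)).
pose G k := li_real (n - k.+1) (fun x => p k x * complex.Im (f x)).
transitivity (\sum_(k < n) (F k +i* G k)); last exact: complex_sum.
apply: eq_bigr => k _; rewrite /dmul.
have -> : (n - k)%N = (n - k.+1).+1 by rewrite subnSK.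
have ReE : (fun x => complex.Re ((p k x)%:C * f x)) =
  (fun x => p k x * complex.Re (f x)).
  by apply/funext => x; exact: Re_realM.
have ImE : (fun x => complex.Im ((p k x)%:C * f x)) =
  (fun x => p k x * complex.Im (f x)).
  by apply/funext => x; exact: Im_realM.
by rewrite (li_nat (n - k.+1) (fun x => (p k x)%:C * f x)) ReE ImE.
Qed.

End reduction_to_reals.

(** * The density *)

Section distribution_value.
Context {R : realType}.
Local Notation mu := (@lebesgue_measure R).
Implicit Types (q phi : R -> R).

Lemma pole_tail_integrable phi (e : R) : 0 < e -> rapid phi ->
  mu.-integrable [set t : R | e < `|t|] (EFin \o (fun t => pole t * tail_integral
    phi t)).
Proof.
move=> e0 rphi; have [C hC] := kernel_tail_integral_le (bern_tempered 0) rphi.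
apply: (@integrable_dominated _ _ _ (C / e)).
- exact: measurable_puncture.
- apply: measurable_funTS; apply: measurable_funM; first exact: measurable_pole.
  by apply: continuous_measurable_fun; exact: tail_integral_continuous.
- move=> t /= et; have t0 : 0 < `|t| by exact: lt_trans et.
  have := hC t; rewrite expr0 mulr1 => h.
  rewrite poleE -?normr_gt0// mulNr normrN mulrAC normrM normfV mulrAC.
  have C0 : 0 <= C by apply: le_trans h; rewrite mulr_ge0// ltW// oneDsqr_gt0.
  apply: ler_pM => //.
  by rewrite lef_pV2 ?posrE// ltW.
Qed.

Definition pv_tail phi : R :=
  lim (\int[mu]_(t in [set t | e < `|t|]) (pole t * tail_integral phi t) @[e -->
    0^'+]).

(** Homogeneity lets the singular terms of all summands be gathered as multiples of one principal
    value. *)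
Lemma pv_tailZ (c : R) phi : rapid phi ->
  pv_tail (fun x => c * phi x) = c * pv_tail phi.
Proof.
move=> rphi; apply/cvg_lim => //.
have : c * \int[mu]_(t in [set t | e < `|t|]) (pole t * tail_integral phi t) @[e -->
  0^'+] -->
    c * pv_tail phi.
  by apply: cvgM; [exact: cvg_cst|exact: cvg_principal_value].
apply: cvg_trans; apply: near_eq_cvg; near=> e.
have e0 : 0 < e by near: e; exact: nbhs_right_gt.
have mA := measurable_puncture e.
rewrite -RintegralZl//; last exact: pole_tail_integrable.
apply: eq_Rintegral => t _; rewrite mulrCA; congr (_ * _).
by rewrite /tail_integral RintegralZl//; exact: rapid_integrable.
Unshelve. all: by end_near. Qed.

Lemma Rintegral_shift q (t : R) : measurable_fun setT q ->
  mu.-integrable setT (EFin \o (fun y => q (y - t))) ->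
  \int[mu]_x q x = \int[mu]_y q (y - t).
Proof.
move=> mq iq; rewrite /Rintegral; congr fine.
pose phi (y : measurableTypeR R) : measurableTypeR R := y - t.
have mphi : measurable_fun setT phi by apply: measurable_funB.
transitivity (\int[pushforward mu phi]_x (q x)%:E)%E.
  (* Translation invariance: the translated measure agrees with Lebesgue measure on half-open
     intervals, which determine it. *)
  apply: eq_measure_integral => A mA _; apply: lebesgue_measure_unique => //.
  move=> _ [[a b]] _ <-.
  have pE : phi @^-1` `]a, b]%classic = `]a + t, b + t]%classic.
    by apply/seteqP; split => x /=; rewrite !in_itv/= ltrBrDr lerBlDr.
  rewrite -[RHS]/(mu (phi @^-1` `]a, b]%classic)) pE.
  rewrite !lebesgue_measure_itv/= !lte_fin ltrD2r; case: ifP => // _.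
  by congr (_%:E); ring.
rewrite integral_pushforward//.
exact/measurable_EFinP.
Qed.

(** The substitution x = y - t turns the density into (y-t)^m/m! on y > t; after binomial expansion
    the powers of t leave the integral. *)
Lemma gamma_density_shift m q (t : R) : rapid q ->
  \int[mu]_x (gamma_density m x * q (x + t)) =
  \sum_(i < m.+1) ('C(m, i)%:R * (- t) ^+ i / m`!%:R) *
    tail_integral (fun y => y ^+ (m - i) * q y) t.
Proof.
move=> rq.
pose h (i : nat) (y : R) := y ^+ (m - i) * q y.
pose c (i : nat) : R := 'C(m, i)%:R * (- t) ^+ i / m`!%:R.
have ih i : (i < m.+1)%N -> mu.-integrable `]t, +oo[ (EFin \o h i).
  by move=> _; apply: rapid_integrable => //; exact: rapidX.
have mI : measurable `]t, +oo[%classic by [].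
have [iS <-] := Rintegral_lincomb c mI ih.
have E (y : R) : gamma_density m (y - t) * q (y - t + t) =
    ((fun y => \sum_(i < m.+1) c i * h i y) \_ `]t, +oo[) y.
  rewrite patchE /gamma_density subr_gt0 subrK; case: ifPn => [ty|ty].
    rewrite mem_set/= ?in_itv/= ?ty// exprDn mulr_suml mulr_suml.
    by apply: eq_bigr => i _; rewrite /c /h -mulr_natl; ring.
  by rewrite memNset ?mul0r//= in_itv/= andbT; exact/negP.
rewrite (@Rintegral_shift _ t).
- by under eq_Rintegral do rewrite E; rewrite -Rintegral_mkcond.
- apply: measurable_funM.
    apply: measurable_fun_ifT => //; first exact: measurable_fun_ltr.
    by apply: measurable_funM => //; exact: exprn_measurable.
  apply: (measurableT_comp (f := q)); last exact: measurable_funD.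
  by apply: continuous_measurable_fun; exact: rq.1.
- rewrite (_ : EFin \o _ =
  (EFin \o (fun y => \sum_(i < m.+1) c i * h i y)) \_ `]t, +oo[).
    by rewrite -integrable_mkcond.
  by rewrite restrict_EFin; apply/funext => y /=; rewrite E.
Qed.

End distribution_value.

(** * The smooth density and the cancellation of the singular terms *)

Section density.
Context {R : realType}.
Local Notation mu := (@lebesgue_measure R).
Implicit Types (q : R -> R).

Definition bern_kernel j (t : R) : R := bern t * (- t) ^+ j.

Definition li_term m q (i : nat) : R :=
  if i is j.+1 then
    \int[mu]_y (head_integral (bern_kernel j) y * (y ^+ (m - j.+1) * q y))
  else pv_tail (fun y => y ^+ m * q y).

(** The binomial sum is split at a fixed e > 0, where every term, the singular one included, is
    integrable; the limit is then taken term by term. *)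
Lemma cvg_li_real m q : rapid q ->
  \int[mu]_(t in [set t | e < `|t|])
    (pole t * \int[mu]_x (gamma_density m x * q (x + t))) @[e --> 0^'+] -->
  \sum_(i < m.+1) ('C(m, i)%:R / m`!%:R) * li_term m q i.
Proof.
move=> rq; pose G (i : nat) (t : R) := if i is j.+1 then
    bern_kernel j t * tail_integral (fun y => y ^+ (m - j.+1) * q y) t
  else pole t * tail_integral (fun y => y ^+ m * q y) t.
have h i : (i < m.+1)%N ->
    \int[mu]_(t in [set t | e < `|t|]) G i t @[e --> 0^'+] --> li_term m q i.
  case: i => [|j] _; first exact: cvg_principal_value (rapidX m rq).
  have kw := @bern_tempered R j; have rw := rapidX (m - j.+1) rq.
  have [C hC] := kernel_tail_integral_le kw rw.
  rewrite /li_term -(kernel_tail_head_Fubini kw rw).2.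
  apply: cvg_integral_puncture hC; apply: continuous_measurable_fun.
  by apply: continuous_funM; [exact: kw.1|exact: tail_integral_continuous].
have FF : Filter (0 : R)^'+ by exact: _.
have hc := cvg_lincomb (c := fun i => 'C(m, i)%:R / m`!%:R) h.
apply: (cvg_trans _ (hc FF)); apply: near_eq_cvg; near=> e.
have e0 : 0 < e by near: e; exact: nbhs_right_gt.
have mA := @measurable_puncture R e.
have iG i : (i < m.+1)%N -> mu.-integrable [set t | e < `|t|] (EFin \o G i).
  case: i => [|j] _; first by apply: pole_tail_integrable => //; exact: rapidX.
  by apply: kernel_tail_integrable => //; [exact: bern_tempered|exact: rapidX].
have [_ <-] := Rintegral_lincomb (fun i => 'C(m, i)%:R / m`!%:R) mA iG.
apply: eq_Rintegral => t; rewrite inE/= => et.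
have t0 : t != 0 by rewrite -normr_gt0 (lt_trans e0).
rewrite gamma_density_shift// mulr_sumr; apply: eq_bigr => -[[|j] jm] _ /=.
  by rewrite subn0 expr0; ring.
(* One factor -t cancels the pole, so the kernel index is j for the binomial index [j.+1]. *)
rewrite poleE// /bern_kernel exprS; field.
by rewrite t0 andbT pnatr_eq0 -lt0n fact_gt0.
Unshelve. all: by end_near. Qed.

(** Collects the binomial terms of index [j.+1] of all summands, with the polynomial factor of each
    [dmul] moved into the density; the terms of index 0 are absent because they cancel for even
    n. *)
Definition density (B : nat -> R) n (y : R) : R :=
  \sum_(k < n) \sum_(j < n - k.+1)
    ('C(n - k.+1, j.+1)%:R / (n - k.+1)`!%:R) *
    (head_integral (bern_kernel j) y *
     (y ^+ (n - k.+1 - j.+1) * (B k * ((- 2 * y) ^+ k / k`!%:R)))).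

Lemma smooth_density (B : nat -> R) n : smooth (density B n).
Proof.
apply: smooth_sum => k; apply: smooth_sum => j.
apply: smoothM; first exact: smoothC.
apply: smoothM.
  by apply: smooth_head_integral; [exact: bern_tempered|exact: smooth_bern_monomial].
apply: smoothM; first by apply: smoothX; exact: smooth_id.
apply: smoothM; first exact: smoothC.
apply: smoothM; last exact: smoothC.
by apply: smoothX; apply: smoothM; [exact: smoothC|exact: smooth_id].
Qed.

Lemma lambda_realE (B : nat -> R) n q : bernoulli_numbers B ->
  (0 < n)%N -> ~~ odd n -> rapid q ->
  mu.-integrable setT (EFin \o (fun y => density B n y * q y)) /\
  lambda_real B n q = \int[mu]_y (density B n y * q y).
Proof.
move=> hB n0 nodd rq.
pose p k (y : R) := B k * ((- 2 * y) ^+ k / k`!%:R).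
have pE k : (fun y => p k y * q y) =
    (fun y => (B k * (-2) ^+ k / k`!%:R) * (y ^+ k * q y)).
  by apply/funext => y; rewrite /p exprMn; ring.
have rp k : rapid (fun y => p k y * q y).
  by rewrite pE; apply: rapidZ; exact: rapidX.
pose c k j : R := 'C(n - k.+1, j.+1)%:R / (n - k.+1)`!%:R.
pose h k j y := head_integral (bern_kernel j) y * (y ^+ (n - k.+1 -
  j.+1) * (p k y * q y)).
have ih k j : mu.-integrable setT (EFin \o h k j).
  by apply: (kernel_tail_head_Fubini _ _).1; [exact: bern_tempered|exact: rapidX].
have inner k := @Rintegral_lincomb R setT (n -
  k.+1) (c k) (h k) measurableT (fun j _ => ih k j).
have [iS eS] := @Rintegral_lincomb R setT n (fun=> 1)
  (fun k y => \sum_(j < n -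
    k.+1) c k j * h k j y) measurableT (fun k _ => (inner k).1).
have dE : (fun y => density B n y * q y) =
    (fun y => \sum_(k < n) 1 * \sum_(j < n - k.+1) c k j * h k j y).
  apply/funext => y; rewrite /density mulr_suml; apply: eq_bigr => k _.
  by rewrite mul1r mulr_suml; apply: eq_bigr => j _; rewrite /c /h /p !mulrA.
rewrite dE; split=> //; rewrite eS.
pose a k : R := B k * (-2) ^+ k / k`!%:R / (n - k.+1)`!%:R.
have liE (k : 'I_n) : li_real (n - k.+1) (fun y => p k y * q y) =
    a k * pv_tail (fun y => y ^+ n.-1 * q y) +
    \sum_(j < n - k.+1) c k j * \int[mu]_y h k j y.
  have -> : li_real (n - k.+1) (fun y => p k y * q y) = _ :=
    cvg_lim (@Rhausdorff R) (cvg_li_real (m := n - k.+1) (rp k)).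
  rewrite (big_ord_recl (n - k.+1)) bin0.
  suff -> : li_term (n - k.+1) (fun y => p k y * q y) 0 =
      (B k * (-2) ^+ k / k`!%:R) * pv_tail (fun y => y ^+ n.-1 * q y).
    by congr (_ + _); rewrite /a mul1r mulrCA mulrA.
  rewrite -pv_tailZ; last exact: rapidX.
  congr pv_tail; apply/funext => y; rewrite /p exprMn.
  (* The powers y^(n-k-1) from the binomial and y^k from the Bernoulli factor multiply to y^(n-1)
     for every k, which makes the principal value common to all summands. *)
  have -> : n.-1 = (n - k.+1 + k)%N by rewrite -{1}(subnK (ltn_ord k)) addnS.
  by rewrite exprD; ring.
rewrite /lambda_real (eq_bigr _ (fun k _ => liE k)) big_split/= -mulr_suml.
rewrite bernoulli_sum_eq0// mul0r add0r; apply: eq_bigr => k _.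
by rewrite mul1r (inner k).2.
Qed.

End density.

Lemma schwartz_rapid (R : realType) (f : R -> R) : schwartz f -> rapid f.
Proof.
move=> [sf bf]; split; first exact: smooth_continuous.
by move=> k; exact: bf k 0%N.
Qed.

Theorem corollary3 (R : realType) (B : nat -> R) (hB : bernoulli_numbers B)
  (n : nat) (hn : (0 < n)%N) (heven : ~~ odd n) :
  exists g : R -> complex R, csmooth g /\ given_by (lambda_i B n) g.
Proof.
exists (fun x => (density B n x)%:C); split.
  by split; [exact: smooth_density|exact: smoothC].
move=> f [sRe sIm].
have [iRe eRe] := lambda_realE hB hn heven (schwartz_rapid sRe).
have [iIm eIm] := lambda_realE hB hn heven (schwartz_rapid sIm).
have ReE : (fun x => complex.Re ((density B n x)%:C * f x)) =
    (fun x => density B n x * complex.Re (f x)).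
  by apply/funext => x; exact: Re_realM.
have ImE : (fun x => complex.Im ((density B n x)%:C * f x)) =
    (fun x => density B n x * complex.Im (f x)).
  by apply/funext => x; exact: Im_realM.
split; first by rewrite /cintegrable ReE ImE.
by rewrite lambda_iE eRe eIm /regular /cintegral ReE ImE.
Qed.
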